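(* Let $\sigma=\begin{pmatrix} m'&m\\ n'&n\end{pmatrix}\in SL_2(\mathbb Z)$ with $n>0$, and let $u\in\mathbb C^*$ (with a fixed root $u^{1/n}$). The following formulas determine an action of $\mathfrak{Diff}_q$ on $F^{n\psi}$: $c$ acts by $n$, $c'$ acts by $n'$, $H_k=E_{0,k}$ ($k\neq 0$) acts by $H_k^{tw}$, and $E_{1,k}$, $E_{-1,k}$ act by the coefficients of $z^{-k}$ in $E^{tw}(z)$, $F^{tw}(z)$, where $$H^{tw}_k=\sum_{a=0}^{n-1}\sum_{i+j=k}\psi_{(a)}[i]\,\psi^*_{(a)}[j],$$ $$E^{tw}(z)=\sum_{\substack{0\le a,b\le n-1\\ b-a\equiv -n' \bmod n}} u^{\frac1n}q^{-1/2}z\,\psi_{(a)}(q^{-1/2}z)\,\psi^*_{(b)}(q^{1/2}z)\,z^{\frac{n'-a+b}{n}}q^{(a+b)/2n},$$ $$F^{tw}(z)=\sum_{\substack{0\le a,b\le n-1\\ b-a\equiv n' \bmod n}} u^{-\frac1n}q^{1/2}z\,\psi_{(a)}(q^{1/2}z)\,\psi^*_{(b)}(q^{-1/2}z)\,z^{\frac{-n'-a+b}{n}}q^{-(a+b)/2n}.$$ The module obtained is isomorphic to $\mathcal M_u^{\sigma}$.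
   Context: $q\in\mathbb C^*$ is not a root of unity; compatible fractional powers of $q$ are fixed. The Lie algebra $\mathfrak{Diff}_q$ has basis $E_{k,l}$ ($(k,l)\in\mathbb Z^2\setminus\{(0,0)\}$), $c$, $c'$, with $c,c'$ central and $[E_{k,l},E_{r,s}]=(q^{(sk-lr)/2}-q^{(lr-sk)/2})E_{k+r,l+s}+\delta_{k,-r}\delta_{l,-s}(c'k+cl)$. It is generated by $c,c'$ and $E_k=E_{1,k}$, $F_k=E_{-1,k}$, $H_k=E_{0,k}$; put $E(z)=\sum_k E_{1,k}z^{-k}$, $F(z)=\sum_k E_{-1,k}z^{-k}$. Twists. $\sigma\in SL_2(\mathbb Z)$ acts on $\mathfrak{Diff}_q$ by the automorphism $\sigma(E_{k,l})=E_{m'k+ml,\,n'k+nl}$, $\sigma(c')=m'c'+n'c$, $\sigma(c)=mc'+nc$. For a module $M$ with action $\rho_M$, $M^\sigma$ is the same vector space with action $\rho_M\circ\sigma$. $n$-fermion space. The algebra generated by $\psi_{(a)}[i],\psi^*_{(b)}[j]$ ($i,j\in\mathbb Z$, $0\le a,b\le n-1$) has relations $\{\psi_{(a)}[i],\psi_{(b)}[j]\}=0$, $\{\psi^*_{(a)}[i],\psi^*_{(b)}[j]\}=0$, $\{\psi_{(a)}[i],\psi^*_{(b)}[j]\}=\delta_{a,b}\delta_{i+j,0}$. $F^{n\psi}$ is the module with cyclic vector $|0,\dots,0\rangle$ such that $\psi_{(a)}[i]|0,\dots,0\rangle=0$ for $i\ge0$ and $\psi^*_{(a)}[j]|0,\dots,0\rangle=0$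 for $j>0$. Currents: $\psi_{(a)}(z)=\sum_i\psi_{(a)}[i]z^{-i-1}$, $\psi^*_{(b)}(z)=\sum_i\psi^*_{(b)}[i]z^{-i}$. Products of currents at proportional points are regular (not normally ordered) products: for $\alpha\neq\beta$, $\psi_{(a)}(\alpha z)\psi^*_{(b)}(\beta z):=\frac{\delta_{a,b}}{(\alpha-\beta)z}+:\psi_{(a)}(\alpha z)\psi^*_{(b)}(\beta z):$, where $:\psi_{(a)}[i]\psi^*_{(b)}[j]:\;=\psi_{(a)}[i]\psi^*_{(b)}[j]$ if $i<0$ and $=-\psi^*_{(b)}[j]\psi_{(a)}[i]$ if $i\ge 0$. The module $\mathcal M_u$ is the space $F^{1\psi}=:F^\psi$ (the case $n=1$, with $\psi=\psi_{(0)}$, $\psi^*=\psi^*_{(0)}$, modes $\psi_i,\psi_i^*$) with action $c\mapsto1$, $c'\mapsto0$, $H_k\mapsto\sum_{i+j=k}\psi_i\psi^*_j$, $E(z)\mapsto uq^{-1/2}z\,\psi(q^{-1/2}z)\psi^*(q^{1/2}z)$, $F(z)\mapsto u^{-1}q^{1/2}z\,\psi(q^{1/2}z)\psi^*(q^{-1/2}z)$. *)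

(* Defs.v *)
From HB Require Import structures.
From mathcomp Require Import all_boot all_order all_algebra.
From mathcomp Require Import generic_quotient ring_quotient.
From mathcomp Require Import boolp classical_sets fsbigop reals complex.
From mathcomp Require Import finmap monalg.
From mathcomp Require Import zify ring.

Set Implicit Arguments.
Unset Strict Implicit.
Unset Printing Implicit Defensive.

Import GRing.Theory.
Local Open Scope ring_scope.
Local Open Scope quotient_scope.

(* The linear extension to the free module {malg K[I]} of a map given on its
   basis I. *)
Section LinearExtension.
Context (K : fieldType) (I : choiceType) (M : lmodType K) (f : I -> M).

Definition lext (x : {malg K[I]}) : M := \sum_(i <- msupp x) x@_i *: f i.

Lemma lextEw (d : {fset I}) x : (msupp x `<=` d)%fset ->
  lext x = \sum_(i <- d) x@_i *: f i.
Proof.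
move=> le; rewrite /lext (big_fset_incl _ le) //= => i _ /mcoeff_outdom ->.
by rewrite scale0r.
Qed.

Lemma lext_is_linear : linear lext.
Proof.
move=> c x y; set d := (msupp x `|` msupp y)%fset.
have ld : (msupp (c *: x + y) `<=` d)%fset.
  apply: (fsubset_trans (msuppD_le _ _)).
  exact/fsetUSS/fsubset_refl/msuppZ_le.
rewrite (lextEw ld) (@lextEw d x) ?fsubsetUl // (@lextEw d y) ?fsubsetUr //.
rewrite scaler_sumr -big_split /=; apply: eq_bigr => i _.
by rewrite mcoeffD mcoeffZ scalerDl scalerA.
Qed.

HB.instance Definition _ :=
  GRing.isLinear.Build K {malg K[I]} M *:%R lext lext_is_linear.

Lemma lextU i : lext << i >> = f i.
Proof.
by rewrite (@lextEw [fset i]%fset) ?msuppU_le // big_seq_fset1 mcoeffUU scale1r.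
Qed.

End LinearExtension.

Lemma lext_eq (K : fieldType) (I : choiceType) (M : lmodType K)
    (f g : {malg K[I]} -> M) : linear f -> linear g ->
  (forall i, f << i >> = g << i >>) -> f =1 g.
Proof.
move=> lf lg fg x.
pose F := GRing.isLinear.Build _ _ _ _ f lf.
pose G := GRing.isLinear.Build _ _ _ _ g lg.
pose f' : {linear _ -> _} := HB.pack f F.
pose g' : {linear _ -> _} := HB.pack g G.
rewrite -[f]/(f' : _ -> _) -[g]/(g' : _ -> _) [x]monalgE !linear_sum.
apply: eq_bigr => i _.
have -> : << x@_i *g i >> = x@_i *: << i >> :> {malg K[I]}.
  apply/malgP => j; rewrite mcoeffZ !mcoeffU.
  by case: (i == j); rewrite ?mulr1n ?mulr0n ?mulr1 ?mulr0.
by rewrite !linearZ /= fg.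
Qed.

(* A fixed compatible choice of rational powers of q:  qp r  stands for q^r. *)
Definition fractional_powers (K : fieldType) (q : K) (qp : rat -> K) : Prop :=
  qp 1 = q /\ forall r s : rat, qp (r + s) = qp r * qp s.

Definition not_root_of_unity (K : fieldType) (q : K) : Prop :=
  forall k : nat, (0 < k)%N -> q ^+ k != 1.

(* The vector space underlying Diff_q: the basis indices are  inl (k, l)  for
   E_{k,l} with (k, l) != (0, 0),  inr true  for c  and  inr false  for c'. *)
Definition diff_index : choiceType :=
  ({p : int * int | p != (0, 0)} + bool)%type.

Definition diff (K : fieldType) : lmodType K := {malg K[diff_index]}.

Section Diff.
Variable K : fieldType.

(* E_{0,0} is not a basis element; dE 0 0 = 0 is a junk value, which only
   occurs in the bracket below with coefficient q^0 - q^0 = 0. *)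
Definition dE (k l : int) : diff K :=
  if insub (k, l) is Some p then << (inl p : diff_index) >> else 0.
Definition dc : diff K := << (inr true : diff_index) >>.
Definition dc' : diff K := << (inr false : diff_index) >>.

Variable qp : rat -> K.

Definition diff_bracket_basis (x y : diff_index) : diff K :=
  match x, y with
  | inl p, inl r =>
      let: (k, l) := val p in let: (r, s) := val r in
      (qp ((s * k - l * r)%:~R / 2) - qp ((l * r - s * k)%:~R / 2))
        *: dE (k + r) (l + s)
      + (if (k == - r) && (l == - s) then k%:~R *: dc' + l%:~R *: dc else 0)
  | _, _ => 0
  end.

Definition diff_bracket (x y : diff K) : diff K :=
  lext (fun i => lext (diff_bracket_basis i) y) x.

End Diff.

Lemma linear_comp_fun (K : fieldType) (U V W : lmodType K)
    (f : V -> W) (g : U -> V) :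
  linear f -> linear g -> linear (fun x => f (g x)).
Proof. by move=> lf lg c x y; rewrite lg lf. Qed.

Lemma linear_add_fun (K : fieldType) (U V : lmodType K) (f g : U -> V) :
  linear f -> linear g -> linear (fun x => f x + g x).
Proof. by move=> lf lg c x y; rewrite lg lf scalerDr addrACA. Qed.

Lemma linear_opp_fun (K : fieldType) (U V : lmodType K) (g : U -> V) :
  linear g -> linear (fun x => - g x).
Proof. by move=> lg c x y; rewrite lg opprD scalerN. Qed.

Lemma linear_zero_fun (K : fieldType) (U V : lmodType K) :
  linear (fun _ : U => 0 : V).
Proof. by move=> c x y; rewrite scaler0 addr0. Qed.

Section LmodFacts.
Variables (K : fieldType) (V : lmodType K).
Implicit Types (a b c d k l : K) (P Q X T : V).

Lemma lmod_regroup a b c X T1 T2 T3 :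
  a *: X + T1 + (b *: X + T2) + (c *: X + T3) =
    (a + b + c) *: X + (T1 + T2 + T3).
Proof. by rewrite !scalerDl (addrACA (a *: X)) [LHS]addrACA. Qed.

Lemma lmod_comb0 a X T : a = 0 -> T = 0 -> a *: X + T = 0.
Proof. by move=> -> ->; rewrite scale0r addr0. Qed.

Lemma lmod_scale0 a b c : a *: (0 : V) + b *: 0 + c *: 0 = 0.
Proof. by rewrite !scaler0 !addr0. Qed.

Lemma lmod_regroup2 a p1 p2 p3 q1 q2 q3 P Q :
    p1 + p2 + p3 = 0 -> q1 + q2 + q3 = 0 ->
  a *: (p1 *: P + q1 *: Q) + a *: (p2 *: P + q2 *: Q)
    + a *: (p3 *: P + q3 *: Q) = 0.
Proof.
move=> hp hq; rewrite -!scalerDr.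
have -> : p1 *: P + q1 *: Q + (p2 *: P + q2 *: Q) + (p3 *: P + q3 *: Q) =
    (p1 + p2 + p3) *: P + (q1 + q2 + q3) *: Q.
  by rewrite !scalerDl (addrACA (p1 *: P)) [LHS]addrACA.
by rewrite hp hq !scale0r addr0 scaler0.
Qed.

Lemma lmod_swap a b c d k l P Q :
  k *: (a *: P + b *: Q) + l *: (c *: P + d *: Q) =
    (a * k + c * l) *: P + (b * k + d * l) *: Q.
Proof.
by rewrite !scalerDr !scalerA addrACA -!scalerDl ![_ * k]mulrC ![_ * l]mulrC.
Qed.

End LmodFacts.

Section DiffFacts.
Variables (K : fieldType) (qp : rat -> K).

Lemma linear_diff_bracketl y : linear ((diff_bracket qp)^~ y).
Proof. by move=> c x x'; rewrite /diff_bracket linearP. Qed.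

Lemma linear_diff_bracketr x : linear (diff_bracket qp x).
Proof.
move=> c y y'; rewrite /diff_bracket /lext scaler_sumr -big_split /=.
apply: eq_bigr => i _; rewrite -!/(lext _ _) linearP scalerDr !scalerA.
by rewrite mulrC.
Qed.

Lemma dE00 : dE K 0 0 = 0.
Proof. by rewrite /dE insubF. Qed.

Lemma dE_neq0 k l (h : (k, l) != (0, 0)) :
  dE K k l = << (inl (Sub (k, l) h : {p : int * int | p != (0, 0)}) :
    diff_index) >>.
Proof. by rewrite /dE insubT. Qed.

Lemma bracket0l y : diff_bracket qp 0 y = 0.
Proof. by rewrite /diff_bracket linear0. Qed.

Lemma bracket0r x : diff_bracket qp x 0 = 0.
Proof.
by rewrite /diff_bracket /lext big1 // => i _; rewrite -/(lext _ _) linear0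
  scaler0.
Qed.

Lemma diff_bracket_dE k l r s :
  diff_bracket qp (dE K k l) (dE K r s) =
    (qp ((s * k - l * r)%:~R / 2) - qp ((l * r - s * k)%:~R / 2))
      *: dE K (k + r) (l + s)
    + (if (k == - r) && (l == - s) then k%:~R *: dc' K + l%:~R *: dc K else 0).
Proof.
have [[-> ->]|kl] := eqVneq (k, l) (0, 0).
  by rewrite dE00 bracket0l !(mulr0, mul0r) subrr scale0r !scale0r !addr0
    if_same addr0.
have [[-> ->]|rs] := eqVneq (r, s) (0, 0).
  rewrite dE00 bracket0r !(mulr0, mul0r) !subrr scale0r oppr0 add0r.
  by case: andP => // -[/eqP -> /eqP ->]; rewrite !scale0r addr0.
by rewrite (dE_neq0 kl) (dE_neq0 rs) /diff_bracket !lextU.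
Qed.

Lemma diff_bracket_cr x : diff_bracket qp x (dc K) = 0.
Proof. by rewrite /diff_bracket /lext big1 // => -[i|i] _; rewrite -/(lext _ _)
  lextU scaler0. Qed.
Lemma diff_bracket_c'r x : diff_bracket qp x (dc' K) = 0.
Proof. by rewrite /diff_bracket /lext big1 // => -[i|i] _; rewrite -/(lext _ _)
  lextU scaler0. Qed.
Lemma diff_bracket_cl x : diff_bracket qp (dc K) x = 0.
Proof. by rewrite /diff_bracket lextU /lext big1 // => i _; rewrite scaler0. Qed.
Lemma diff_bracket_c'l x : diff_bracket qp (dc' K) x = 0.
Proof. by rewrite /diff_bracket lextU /lext big1 // => i _; rewrite scaler0. Qed.

Lemma diff_ext (V : lmodType K) (f g : diff K -> V) : linear f -> linear g ->
    (forall k l, f (dE K k l) = g (dE K k l)) ->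
    f (dc K) = g (dc K) -> f (dc' K) = g (dc' K) -> f =1 g.
Proof.
move=> lf lg hE hc hc'; apply: lext_eq => // -[[[k l] h]|[]] //.
have <- : dE K k l = << (inl (exist _ (k, l) h) : diff_index) >> by rewrite
  (dE_neq0 h).
exact: hE.
Qed.

Lemma diff_bracket_anti x y : diff_bracket qp x y = - diff_bracket qp y x.
Proof.
move: x; apply: (@diff_ext _ _ (fun x => - diff_bracket qp y x)); [exact:
  linear_diff_bracketl | exact/linear_opp_fun/linear_diff_bracketr| | |]; last
  2 first.
- by rewrite diff_bracket_cr diff_bracket_cl oppr0.
- by rewrite diff_bracket_c'r diff_bracket_c'l oppr0.
move=> k l; move: y; apply: (@diff_ext _ _ (fun y => - diff_bracket qp y _));
  [exact: linear_diff_bracketr | exact/linear_opp_fun/linear_diff_bracketl| |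
  |]; last 2 first.
- by rewrite diff_bracket_cr diff_bracket_cl oppr0.
- by rewrite diff_bracket_c'r diff_bracket_c'l oppr0.
move=> r s; rewrite !diff_bracket_dE [r + k]addrC [s + l]addrC opprD -scaleNr
  opprB.
congr (_ + _).
have -> : (r == - k) && (s == - l) = (k == - r) && (l == - s) by lia.
case: ifP => [/andP[/eqP -> /eqP ->]|_]; last by rewrite oppr0.
by rewrite !rmorphN /= !scaleNr opprD.
Qed.

Lemma diff_bracket_jacobi (qpD : forall r s, qp (r + s) = qp r * qp s) x y z :
  diff_bracket qp x (diff_bracket qp y z) + diff_bracket qp y (diff_bracket qp
    z x) + diff_bracket qp z (diff_bracket qp x y) = 0.
Proof.
have lr := linear_diff_bracketr; have ll := linear_diff_bracketl.
move: x; apply: (@diff_ext _ _ (fun x => 0)); [|exact: linear_zero_fun|..];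
  last 2 first.
- by rewrite !(diff_bracket_cl, diff_bracket_cr, bracket0r) !addr0.
- by rewrite !(diff_bracket_c'l, diff_bracket_c'r, bracket0r) !addr0.
- exact: linear_add_fun (linear_add_fun (ll (diff_bracket qp y z))
    (linear_comp_fun (lr y) (lr z))) (linear_comp_fun (lr z) (ll y)).
move=> k1 l1.
move: y; apply: (@diff_ext _ _ (fun x => 0)); [|exact: linear_zero_fun|..];
  last 2 first.
- by rewrite !(diff_bracket_cl, diff_bracket_cr, bracket0r) !addr0.
- by rewrite !(diff_bracket_c'l, diff_bracket_c'r, bracket0r) !addr0.
- exact: linear_add_fun (linear_add_fun (linear_comp_fun (lr (dE K k1 l1)) (ll
    z)) (ll (diff_bracket qp z (dE K k1 l1)))) (linear_comp_fun (lr z) (lr (dE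
    K k1 l1))).
move=> k2 l2.
move: z; apply: (@diff_ext _ _ (fun x => 0)); [|exact: linear_zero_fun|..];
  last 2 first.
- by rewrite !(diff_bracket_cl, diff_bracket_cr, bracket0r) !addr0.
- by rewrite !(diff_bracket_c'l, diff_bracket_c'r, bracket0r) !addr0.
- exact: linear_add_fun (linear_add_fun (linear_comp_fun (lr (dE K k1 l1)) (lr
    (dE K k2 l2))) (linear_comp_fun (lr (dE K k2 l2)) (ll (dE K k1 l1)))) (ll
    (diff_bracket qp (dE K k1 l1) (dE K k2 l2))).
move=> k3 l3.
have bZ x (c : K) y t : t = 0 \/ (exists a b, t = a *: dc' K + b *: dc K) ->
  diff_bracket qp x (c *: y + t) = c *: diff_bracket qp x y.
  move=> ht; rewrite lr; suff -> : diff_bracket qp x t = 0 by rewrite addr0.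
  case: ht => [->|[a [b ->]]]; first exact: bracket0r.
  by rewrite lr -[b *: _]addr0 lr diff_bracket_cr diff_bracket_c'r bracket0r
    !scaler0 !addr0.
have hif (b : bool) (k l : int) : (if b then k%:~R *: dc' K + l%:~R *: dc K
  else 0) = 0 \/
   (exists a c : K, (if b then k%:~R *: dc' K + l%:~R *: dc K else 0) = a *:
     dc' K + c *: dc K).
  by case: b; [right; do 2!eexists | left].
rewrite !diff_bracket_dE !bZ //; try exact: hif.
rewrite !diff_bracket_dE.
pose A (t : int) := qp (t%:~R / 2) - qp ((-t)%:~R / 2).
have qN t : (- t)%:~R / 2 = - (t%:~R / 2) :> rat by rewrite rmorphN /= mulNr.
have eA (a b : int) : qp ((a - b)%:~R / 2) - qp ((b - a)%:~R / 2) = A (a - b)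
  by rewrite /A opprB.
rewrite !eA.
have [-> ->] : k2 + (k3 + k1) = k1 + (k2 + k3) /\ l2 + (l3 + l1) = l1 + (l2 +
  l3) by split; ring.
have [-> ->] : k3 + (k1 + k2) = k1 + (k2 + k3) /\ l3 + (l1 + l2) = l1 + (l2 +
  l3) by split; ring.
have e1 : (k2 == - (k3 + k1)) && (l2 == - (l3 + l1)) = (k1 == - (k2 + k3)) &&
  (l1 == - (l2 + l3)) by lia.
have e2 : (k3 == - (k1 + k2)) && (l3 == - (l1 + l2)) = (k1 == - (k2 + k3)) &&
  (l1 == - (l2 + l3)) by lia.
rewrite e1 e2 !scalerDr !scalerA.
set X := dE K _ _.
set w12 := l2 * k1 - l1 * k2; set w23 := l3 * k2 - l2 * k3; set w31 := l1 * k3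
  - l3 * k1.
have -> : (l2 + l3) * k1 - l1 * (k2 + k3) = w12 - w31 by rewrite /w12 /w31; ring.
have -> : (l3 + l1) * k2 - l2 * (k3 + k1) = w23 - w12 by rewrite /w12 /w23; ring.
have -> : (l1 + l2) * k3 - l3 * (k1 + k2) = w31 - w23 by rewrite /w31 /w23; ring.
have AB a b : A (a - b) = qp (a%:~R / 2) * qp ((-b)%:~R / 2) - qp ((-a)%:~R/2)
  * qp (b%:~R/2).
  rewrite /A -!qpD; congr (qp _ - qp _); rewrite -mulrDl -rmorphD //; congr
    (_%:~R / _); ring.
rewrite (AB w12) (AB w23) (AB w31).
have intrN0 a b : (- (a + b))%:~R + a%:~R + b%:~R = 0 :> K.
  by rewrite rmorphN rmorphD /=; ring.
rewrite lmod_regroup lmod_comb0 //; first by rewrite /A; ring.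
case: ifP => [/andP[/eqP hk /eqP hl]|_]; last exact: lmod_scale0.
have -> : w31 = w23 by rewrite /w31 /w23 hk hl; ring.
have -> : w12 = w23 by rewrite /w12 /w23 hk hl; ring.
by apply: lmod_regroup2; [rewrite hk|rewrite hl]; exact: intrN0.
Qed.

End DiffFacts.

(* rho is an action of the Lie algebra Diff_q on V. *)
Definition diff_action (K : fieldType) (qp : rat -> K) (V : lmodType K)
    (rho : diff K -> V -> V) : Prop :=
  [/\ forall v, linear (rho ^~ v),
      forall x, linear (rho x)
    & forall x y v,
        rho (diff_bracket qp x y) v = rho x (rho y v) - rho y (rho x v)].

(* The automorphism of Diff_q attached to the matrix
   sigma = ((m', m), (n', n)) of SL_2(Z). *)
Definition diff_twist_basis (K : fieldType) (sigma : 'M[int]_2)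
    (x : diff_index) : diff K :=
  let m' := sigma 0 0 in let m := sigma 0 1 in
  let n' := sigma 1 0 in let n := sigma 1 1 in
  match x with
  | inl p => let: (k, l) := val p in dE K (m' * k + m * l) (n' * k + n * l)
  | inr true => m%:~R *: dc' K + n%:~R *: dc K
  | inr false => m'%:~R *: dc' K + n'%:~R *: dc K
  end.

Definition diff_twist (K : fieldType) (sigma : 'M[int]_2) :
  diff K -> diff K := lext (diff_twist_basis K sigma).

Lemma diff_twist_dE (K : fieldType) (sigma : 'M[int]_2) k l :
  diff_twist sigma (dE K k l) =
    dE K (sigma 0 0 * k + sigma 0 1 * l) (sigma 1 0 * k + sigma 1 1 * l).
Proof.
have [[-> ->]|kl] := eqVneq (k, l) (0, 0).
  by rewrite !mulr0 addr0 dE00 /diff_twist linear0.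
by rewrite (dE_neq0 _ kl) /diff_twist lextU.
Qed.

Lemma diff_twist_bracket (K : fieldType) (qp : rat -> K) (sigma : 'M[int]_2)
    x y : \det sigma = 1 ->
  diff_twist sigma (diff_bracket qp x y) =
    diff_bracket qp (diff_twist sigma x) (diff_twist sigma y).
Proof.
move=> hdet.
have {}hdet : sigma 0 0 * sigma 1 1 - sigma 0 1 * sigma 1 0 = 1.
  rewrite -hdet (expand_det_row _ 0) !big_ord_recl big_ord0 addr0 /cofactor.
  rewrite !det_mx11 !mxE /= !(expr0, expr1, mul1r, mulN1r, mulrN).
  by congr (sigma _ _ * sigma _ _ - sigma _ _ * sigma _ _); apply: val_inj.
have lt : linear (@diff_twist K sigma) by move=> a u v; exact: linearP.
have ltZ a z : diff_twist sigma (a *: z : diff K) = a *: diff_twist sigma z.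
  exact: linearZ.
have tw_c : diff_twist sigma (dc K) =
    (sigma 0 1)%:~R *: dc' K + (sigma 1 1)%:~R *: dc K by exact: lextU.
have tw_c' : diff_twist sigma (dc' K) =
    (sigma 0 0)%:~R *: dc' K + (sigma 1 0)%:~R *: dc K by exact: lextU.
have cr z (a b : K) : diff_bracket qp z (a *: dc' K + b *: dc K) = 0.
  rewrite linear_diff_bracketr -[b *: _]addr0 linear_diff_bracketr.
  by rewrite diff_bracket_cr diff_bracket_c'r bracket0r !scaler0 !addr0.
have cl z (a b : K) : diff_bracket qp (a *: dc' K + b *: dc K) z = 0.
  by rewrite diff_bracket_anti cr oppr0.
have t0 : diff_twist sigma 0 = 0 :> diff K by rewrite /diff_twist linear0.
move: x; apply: (@diff_ext _ _
  (fun x => diff_twist sigma (diff_bracket qp x y))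
  (fun x => diff_bracket qp (diff_twist sigma x) (diff_twist sigma y))).
- exact: linear_comp_fun lt (linear_diff_bracketl qp y).
- exact: linear_comp_fun (linear_diff_bracketl qp (diff_twist sigma y)) lt.
- move=> k l; move: y; apply: diff_ext.
  + exact: linear_comp_fun lt (linear_diff_bracketr qp (dE K k l)).
  + exact: linear_comp_fun
      (linear_diff_bracketr qp (diff_twist sigma (dE K k l))) lt.
  + move=> r s; rewrite !diff_twist_dE !diff_bracket_dE.
    rewrite lt diff_twist_dE.
    set m' := sigma 0 0 in hdet tw_c' *; set m := sigma 0 1 in hdet tw_c *.
    set n' := sigma 1 0 in hdet tw_c' *; set n := sigma 1 1 in hdet tw_c *.
    have area a b c d : (n' * a + n * b) * (m' * c + m * d)
        - (n' * c + n * d) * (m' * a + m * b) = b * c - d * a.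
      by rewrite -[RHS]mul1r -hdet; ring.
    rewrite !area.
    have -> : m' * k + m * l + (m' * r + m * s) = m' * (k + r) + m * (l + s).
      by ring.
    have -> : n' * k + n * l + (n' * r + n * s) = n' * (k + r) + n * (l + s).
      by ring.
    have -> : (m' * k + m * l == - (m' * r + m * s)) &&
        (n' * k + n * l == - (n' * r + n * s)) = (k == - r) && (l == - s).
      apply/andP/andP => -[/eqP h1 /eqP h2]; last first.
        by rewrite h1 h2; split; apply/eqP; ring.
      split; apply/eqP.
        transitivity (n * (m' * k + m * l) - m * (n' * k + n * l)).
          by rewrite -[LHS]mul1r -hdet; ring.
        by rewrite h1 h2 -[RHS]mul1r -hdet; ring.
      transitivity (m' * (n' * k + n * l) - n' * (m' * k + m * l)).
        by rewrite -[LHS]mul1r -hdet; ring.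
      by rewrite h1 h2 -[RHS]mul1r -hdet; ring.
    apply: (congr1 (fun t => _ *: _ + t)).
    case: ifP => _; last exact: t0.
    rewrite (lt k%:~R) ltZ tw_c tw_c'.
    by rewrite !rmorphD !rmorphM /=; exact: lmod_swap.
  + by rewrite tw_c cr diff_bracket_cr t0.
  + by rewrite tw_c' cr diff_bracket_c'r t0.
- by rewrite tw_c cl diff_bracket_cl t0.
- by rewrite tw_c' cl diff_bracket_c'l t0.
Qed.

(* The fermion space F^{n psi}: the quotient of the free associative algebra on
   the letters psi_(a)[i] and psi^*_(a)[i] by the left ideal generated by the
   two-sided ideal of the anticommutation relations and by the letters that
   annihilate the vacuum. *)
Section Fock.
Variables (K : fieldType) (n : nat).

Definition letter : choiceType := ('I_n * int + 'I_n * int)%type.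

Definition free_alg : lalgType K := {malg K[{fmonom letter}]}.

Definition gpsi (a : 'I_n) (i : int) : free_alg :=
  << fmu (inl (a, i) : letter) >>.
Definition gpsis (a : 'I_n) (i : int) : free_alg :=
  << fmu (inr (a, i) : letter) >>.

Definition anticomm (x y : free_alg) : free_alg := x * y + y * x.

Inductive clifford_relator : free_alg -> Prop :=
| rel_psi_psi a i b j : clifford_relator (anticomm (gpsi a i) (gpsi b j))
| rel_psis_psis a i b j : clifford_relator (anticomm (gpsis a i) (gpsis b j))
| rel_psi_psis a i b j : clifford_relator
    (anticomm (gpsi a i) (gpsis b j) - ((a == b) && (i + j == 0))%:R).

Inductive annihilator : free_alg -> Prop :=
| ann_psi a i : 0 <= i -> annihilator (gpsi a i)
| ann_psis a j : 0 < j -> annihilator (gpsis a j).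

Inductive fock_relation : free_alg -> Prop :=
| fock_rel0 : fock_relation 0
| fock_relD x y : fock_relation x -> fock_relation y -> fock_relation (x + y)
| fock_rel_cliff x r y : clifford_relator r -> fock_relation (x * r * y)
| fock_rel_ann x r : annihilator r -> fock_relation (x * r).

Definition fock_ideal : {pred free_alg} := [pred x | `[< fock_relation x >]].

Lemma fock_idealP x : reflect (fock_relation x) (x \in fock_ideal).
Proof. exact: asboolP. Qed.

Lemma fock_relation_mull x y : fock_relation y -> fock_relation (x * y).
Proof.
elim=> [|y1 y2 _ h1 _ h2|y1 r y2 hr|y1 r hr].
- by rewrite mulr0; exact: fock_rel0.
- by rewrite mulrDr; exact: fock_relD.
- by rewrite !mulrA; exact: fock_rel_cliff.
- by rewrite mulrA; exact: fock_rel_ann.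
Qed.

Lemma fock_relationZ c y : fock_relation y -> fock_relation (c *: y).
Proof. by move=> hy; rewrite -[y]mul1r scalerAl; exact: fock_relation_mull. Qed.

Lemma fock_ideal_zmod_closed : zmod_closed fock_ideal.
Proof.
split=> [|x y /fock_idealP hx /fock_idealP hy]; apply/fock_idealP.
  exact: fock_rel0.
by apply: fock_relD hx _; rewrite -scaleN1r; exact: fock_relationZ.
Qed.

HB.instance Definition _ :=
  GRing.isZmodClosed.Build free_alg fock_ideal fock_ideal_zmod_closed.

Definition fock_quot := Quotient.quot fock_ideal.

HB.instance Definition _ := GRing.Zmodule.on fock_quot.

Definition fock_pi (x : free_alg) : fock_quot := \pi x.

Lemma fock_piE x y : (fock_pi x == fock_pi y) = (x - y \in fock_ideal).
Proof. by rewrite /fock_pi Quotient.idealrBE. Qed.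

Lemma fock_reprK v : fock_pi (repr v) = v.
Proof. exact: reprK. Qed.

Lemma fock_piB : {morph fock_pi : x y / x - y}.
Proof. by move=> x y; rewrite /fock_pi raddfB. Qed.

Lemma fock_piD : {morph fock_pi : x y / x + y}.
Proof. by move=> x y; rewrite /fock_pi raddfD. Qed.

Definition fock_scale (c : K) (v : fock_quot) : fock_quot :=
  fock_pi (c *: repr v).

Lemma fock_scale_pi c x : fock_scale c (fock_pi x) = fock_pi (c *: x).
Proof.
apply/eqP; rewrite fock_piE -scalerBr; apply/fock_idealP/fock_relationZ.
by apply/fock_idealP; rewrite -fock_piE fock_reprK.
Qed.

Lemma fock_scaleA c d v : fock_scale c (fock_scale d v) = fock_scale (c * d) v.
Proof. by rewrite -[v]fock_reprK !fock_scale_pi scalerA. Qed.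

Lemma fock_scale1 : left_id 1 fock_scale.
Proof. by move=> v; rewrite -[v]fock_reprK fock_scale_pi scale1r. Qed.

Lemma fock_scaleDr : right_distributive fock_scale +%R.
Proof.
move=> c v w; rewrite -[v]fock_reprK -[w]fock_reprK.
by rewrite -fock_piD !fock_scale_pi scalerDr fock_piD.
Qed.

Lemma fock_scaleDl v : {morph fock_scale^~ v : c d / c + d}.
Proof.
by move=> c d; rewrite -[v]fock_reprK !fock_scale_pi scalerDl fock_piD.
Qed.

HB.instance Definition _ := GRing.Zmodule_isLmodule.Build K fock_quot
  fock_scaleA fock_scale1 fock_scaleDr fock_scaleDl.

Definition fock : lmodType K := fock_quot.

Definition vac : fock := fock_pi 1.

Definition fock_act (x : free_alg) (v : fock) : fock := fock_pi (x * repr v).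

Lemma fock_act_pi x y : fock_act x (fock_pi y) = fock_pi (x * y).
Proof.
apply/eqP; rewrite fock_piE -mulrBr; apply/fock_idealP/fock_relation_mull.
by apply/fock_idealP; rewrite -fock_piE fock_reprK.
Qed.

Definition psi (a : 'I_n) (i : int) : fock -> fock := fock_act (gpsi a i).
Definition psis (a : 'I_n) (i : int) : fock -> fock := fock_act (gpsis a i).

(* A current A(z) = \sum_N A_N z^N is the sequence of its coefficients; those
   used below are infinite sums of operators of which only finitely many terms
   are nonzero on a given vector. *)
Definition current := int -> fock -> fock.

Definition nord (a : 'I_n) (i : int) (b : 'I_n) (j : int) (w : fock) : fock :=
  if i < 0 then psi a i (psis b j w) else - psis b j (psi a i w).

(* :psi_(a)(al z) psi^*_(b)(be z): , where psi_(a)[i] psi^*_(b)[j] comes with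
   al^(-i-1) be^(-j) z^(-i-1-j). *)
Definition nprod (al : K) (a : 'I_n) (be : K) (b : 'I_n) : current :=
  fun N w => \sum_(i \in [set: int])
    (al ^ (- i - 1) * be ^ (N + i + 1)) *: nord a i b (- N - i - 1) w.

(* The regular product psi_(a)(al z) psi^*_(b)(be z), for al != be. *)
Definition rprod (al : K) (a : 'I_n) (be : K) (b : 'I_n) : current :=
  fun N w => ((a == b) && (N == -1))%:R / (al - be) *: w + nprod al a be b N w.

(* The current c z^d A(z). *)
Definition monomial_mul (c : K) (d : int) (A : current) : current :=
  fun N w => c *: A (N - d) w.

Definition H_tw (k : int) (w : fock) : fock :=
  \sum_(a < n) \sum_(i \in [set: int]) psi a i (psis a (k - i) w).

Variables (qp : rat -> K) (n' : int) (u1n : K).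

(* The exponents (n' - a + b)/n of z are integers on the ranges of summation. *)
Definition E_tw : current := fun N w =>
  \sum_(a < n) \sum_(b < n | (b%:Z - a%:Z == - n' %[mod n%:Z])%Z)
    monomial_mul (u1n * qp (- (1 / 2)) * qp ((a + b)%:R / (2 * n)%:R))
      (1 + ((n' - a%:Z + b%:Z) %/ n%:Z)%Z)
      (rprod (qp (- (1 / 2))) a (qp (1 / 2)) b) N w.

Definition F_tw : current := fun N w =>
  \sum_(a < n) \sum_(b < n | (b%:Z - a%:Z == n' %[mod n%:Z])%Z)
    monomial_mul (u1n^-1 * qp (1 / 2) * qp (- ((a + b)%:R / (2 * n)%:R)))
      (1 + ((- n' - a%:Z + b%:Z) %/ n%:Z)%Z)
      (rprod (qp (1 / 2)) a (qp (- (1 / 2))) b) N w.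

(* The action of Diff_q on F^{n psi} given by the twisted currents; u1n is the
   chosen root u^(1/n). *)
Definition is_twisted_action (rho : diff K -> fock -> fock) : Prop :=
  diff_action qp rho /\
  [/\ forall w, rho (dc K) w = n%:R *: w,
      forall w, rho (dc' K) w = n'%:~R *: w,
      forall k w, k != 0 -> rho (dE K 0 k) w = H_tw k w,
      forall k w, rho (dE K 1 k) w = E_tw (- k) w
    & forall k w, rho (dE K (-1) k) w = F_tw (- k) w].

End Fock.

(* The action of Diff_q on F^psi that makes it the module M_u. *)
Definition is_Mu_action (K : fieldType) (qp : rat -> K) (u : K)
    (rho : diff K -> fock K 1 -> fock K 1) : Prop :=
  diff_action qp rho /\
  [/\ forall w, rho (dc K) w = w,
      forall w, rho (dc' K) w = 0,
      forall k w, k != 0 -> rho (dE K 0 k) w =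
        \sum_(i \in [set: int]) psi ord0 i (psis ord0 (k - i) w),
      forall k w, rho (dE K 1 k) w =
        monomial_mul (u * qp (- (1 / 2))) 1
          (rprod (qp (- (1 / 2))) ord0 (qp (1 / 2)) ord0) (- k) w
    & forall k w, rho (dE K (-1) k) w =
        monomial_mul (u^-1 * qp (1 / 2)) 1
          (rprod (qp (1 / 2)) ord0 (qp (- (1 / 2))) ord0) (- k) w].

Definition diff_module_iso (K : fieldType) (V W : lmodType K)
    (rho : diff K -> V -> V) (rho' : diff K -> W -> W) : Prop :=
  exists f : {linear V -> W},
    bijective f /\ forall x v, f (rho x v) = rho' x (f v).

(* Main.v *)
From HB Require Import structures.
Require Import Defs.
From mathcomp Require Import all_boot all_order all_algebra reals complex.
From mathcomp Require Import boolp classical_sets functions fsbigop.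
From mathcomp Require Import finmap monalg.
From mathcomp Require Import zify ring.

Set Implicit Arguments.
Unset Strict Implicit.
Unset Printing Implicit Defensive.

Import Order.TTheory GRing.Theory Num.Theory.
Local Open Scope ring_scope.

(* Reading psi_(a)[i] as psi_(ni+a) and psi^*_(b)[j] as psi^*_(nj-b) identifies
   F^{n psi} with F^psi, vacuum included.  In M_u the generator E_{k,l} acts by
     u^k \sum_(i+j=l) q^(k(i-j)/2) :psi_i psi^*_j: + delta_{l,0} u^k/(1-q^k).
   Rescaling psi_i by u^(-mi/n) q^(-m i^2/(2n)), and psi^*_(-i) inversely, turns
   the operator of sigma(E_{k,l}) into
     u^(k/n) \sum_(i+j=n'k+nl) q^(k(i-j)/(2n)) :psi_i psi^*_j:
   up to the constant term, and for k = 0, 1, -1 these are the modes of H^tw,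
   E^tw and F^tw.  An action is determined by these modes because q is not a
   root of unity, so that brackets with E_{1,s} and E_{-1,s} produce every
   E_{k,l} from them. *)

(** * Finitely supported sums *)

Section FiniteSupport.
Variable I : choiceType.

Definition finitely_supported (V : zmodType) (F : I -> V) : Prop :=
  exists s : {fset I}, forall i, i \notin s -> F i = 0.

Lemma finitely_supported_morph (V W : zmodType) (f : V -> W) (F : I -> V) :
  {morph f : x y / x + y} -> finitely_supported F ->
    finitely_supported (fun i => f (F i)).
Proof.
move=> fD [s hs]; exists s => i /hs ->.
by apply: (@addrI _ (f 0)); rewrite -fD !addr0.
Qed.

Lemma finitely_supportedD (V : zmodType) (F G : I -> V) :
  finitely_supported F -> finitely_supported G ->
    finitely_supported (fun i => F i + G i).
Proof.
move=> [s hs] [t ht]; exists (s `|` t)%fset => i.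
by rewrite in_fsetU negb_or => /andP[/hs -> /ht ->]; rewrite addr0.
Qed.

Lemma finitely_supportedZ (K : nzRingType) (V : lmodType K) (c : I ->
  K) (F : I -> V) :
  finitely_supported F -> finitely_supported (fun i => c i *: F i).
Proof. by move=> [s hs]; exists s => i /hs ->; rewrite scaler0. Qed.

Lemma fsumD (V : zmodType) (F G : I -> V) : finitely_supported F ->
  finitely_supported G ->
  \sum_(i \in [set: I]) (F i + G i) =
    \sum_(i \in [set: I]) F i + \sum_(i \in [set: I]) G i.
Proof.
move=> [s hs] [t ht]; rewrite (@fsbigTE _ _ _ _ (s `|` t)%fset); last first.
  by move=> i; rewrite in_fsetU negb_or => /andP[/hs -> /ht ->]; rewrite addr0.
rewrite big_split; congr (_ + _); apply/esym/fsbigTE => i;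
  by rewrite in_fsetU negb_or => /andP[hi hj]; rewrite ?hs ?ht.
Qed.

Lemma fsum_morph (V W : zmodType) (f : V -> W) (F : I -> V) :
  {morph f : x y / x + y} -> finitely_supported F ->
  f (\sum_(i \in [set: I]) F i) = \sum_(i \in [set: I]) f (F i).
Proof.
move=> fD [s hs].
have f0 : f 0 = 0 by apply: (@addrI _ (f 0)); rewrite -fD !addr0.
rewrite (fsbigTE s) // (fsbigTE s) => [|i /hs -> //].
exact: (big_morph f fD f0).
Qed.

Lemma fsum_single (V : zmodType) (F : I -> V) j :
  (forall i, i != j -> F i = 0) -> \sum_(i \in [set: I]) F i = F j.
Proof.
move=> h; rewrite (@fsbigTE _ _ _ _ [fset j]%fset) ?big_seq_fset1 // => i.
by rewrite in_fset1 => /h.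
Qed.

Lemma eq_fsumr (V : zmodType) (F G : I -> V) : F =1 G ->
  \sum_(i \in [set: I]) F i = \sum_(i \in [set: I]) G i.
Proof. by move=> FG; apply: eq_fsbigr => i _; exact: FG. Qed.

End FiniteSupport.

Lemma finitely_supported_interval (V : zmodType) (F : int -> V) (a b : int) :
  (forall i, i < a -> F i = 0) -> (forall i, b <= i -> F i = 0) ->
    finitely_supported F.
Proof.
move=> ha hb; exists [fset (a + k%:Z)%R | k in iota 0 (absz (b - a))]%fset => i
  hi.
have [/ha //|ai] := ltP i a; have [/hb //|ib] := leP b i.
case/negP: hi; apply/imfsetP; exists (absz (i - a)) => /=; last by lia.
by rewrite mem_iota; lia.
Qed.

Lemma finitely_supported_shift (V : zmodType) (F : int -> V) (l : int) :
  finitely_supported F -> finitely_supported (fun i => F (l + i)).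
Proof.
move=> [s hs]; exists [fset (i - l)%R | i in s]%fset => i hi; apply: hs.
apply: contra hi => hi; apply/imfsetP; exists (l + i) => //=; lia.
Qed.

Lemma fsum_shift (V : zmodType) (F : int -> V) (l : int) :
  \sum_(i \in [set: int]) F (l + i) = \sum_(i \in [set: int]) F i.
Proof.
by apply/esym/reindex_fsbigT; exists (fun i => i - l) => i; lia.
Qed.

(** * Bilinear operators in a system of fermions *)

Section Fermions.
Variables (K : fieldType) (V : lmodType K).

Lemma linearD_of (U W : lmodType K) (f : U -> W) :
  linear f -> {morph f : x y / x + y}.
Proof. by move=> lf x y; rewrite -[x]scale1r lf !scale1r. Qed.

Lemma linear0_of (U W : lmodType K) (f : U -> W) : linear f -> f 0 = 0.
Proof.
by move=> /linearD_of fD; apply: (@addrI _ (f 0)); rewrite -fD !addr0.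
Qed.

Lemma linearZ_of (U W : lmodType K) (f : U -> W) c x :
  linear f -> f (c *: x) = c *: f x.
Proof. by move=> lf; rewrite -[c *: x]addr0 lf (linear0_of lf) addr0. Qed.

Lemma linearN_of (U W : lmodType K) (f : U -> W) x :
  linear f -> f (- x) = - f x.
Proof. by move=> lf; rewrite -scaleN1r (linearZ_of _ _ lf) scaleN1r. Qed.

Lemma linearB_of (U W : lmodType K) (f : U -> W) :
  linear f -> {morph f : x y / x - y}.
Proof.
by move=> lf x y; rewrite addrC -scaleN1r lf scaleN1r addrC.
Qed.

(* The induction principle says that v0 is cyclic; irreducibility of V is never
   needed. *)
Record fermions (p ps : int -> V -> V) (v0 : V) : Prop := Fermions {
  fermion_lin : forall i, linear (p i);
  fermions_lin : forall i, linear (ps i);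
  fermion_pp : forall i j v, p i (p j v) = - p j (p i v);
  fermion_ss : forall i j v, ps i (ps j v) = - ps j (ps i v);
  fermion_ps : forall i j v,
    p i (ps j v) = (i + j == 0)%:R *: v - ps j (p i v);
  fermion_ann : forall i, 0 <= i -> p i v0 = 0;
  fermions_ann : forall j, 0 < j -> ps j v0 = 0;
  fermion_ind : forall P : V -> Prop, P v0 ->
    (forall c x y, P x -> P y -> P (c *: x + y)) ->
    (forall i x, P x -> P (p i x)) -> (forall i x, P x -> P (ps i x)) ->
    forall x, P x }.

Variables (p ps : int -> V -> V) (v0 : V).
Hypothesis fer : fermions p ps v0.

Let plin := fermion_lin fer.
Let pslin := fermions_lin fer.

Lemma fermion_locally_finite v :
  exists M : int, forall i, M <= i -> p i v = 0 /\ ps i v = 0.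
Proof.
move: v; apply: (fermion_ind fer) => [|c x y [M hM] [N hN]|r x [M hM]|r x [M
  hM]].
- by exists 1 => i hi; rewrite (fermion_ann fer) ?(fermions_ann fer) //; lia.
- exists (Num.max M N) => i; rewrite ge_max => /andP[/hM[h1 h2] /hN[h3 h4]].
  by rewrite plin pslin h1 h2 h3 h4 scaler0 addr0.
- exists (Num.max M (1 - r)) => i; rewrite ge_max => /andP[/hM[h1 h2] hr].
  rewrite (fermion_pp fer) h1 (linear0_of (plin r)) oppr0; split=> //.
  have := fermion_ps fer r i x; rewrite h2 (linear0_of (plin r)).
  by rewrite (_ : _ == 0 = false) ?scale0r ?sub0r; [move/esym/eqP;
    rewrite oppr_eq0 => /eqP|lia].
- exists (Num.max M (1 - r)) => i; rewrite ge_max => /andP[/hM[h1 h2] hr].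
  rewrite (fermion_ss fer) h2 (linear0_of (pslin r)) oppr0; split=> //.
  rewrite (fermion_ps fer) h1 (linear0_of (pslin r)) subr0.
  by rewrite (_ : _ == 0 = false) ?scale0r //; lia.
Qed.

Definition normal_ordered (i j : int) (v : V) : V :=
  if i < 0 then p i (ps j v) else - ps j (p i v).

Lemma normal_orderedE i j v :
  p i (ps j v) =
    normal_ordered i j v + ((i + j == 0) && (0 <= i))%:R *: v.
Proof.
rewrite /normal_ordered; case: ltP => _; first by rewrite andbF scale0r addr0.
by rewrite andbT addrC (fermion_ps fer).
Qed.

Lemma normal_ordered_linear i j : linear (normal_ordered i j).
Proof.
move=> c x y; rewrite /normal_ordered; case: ifP => _.
  by rewrite (pslin j) plin.
by rewrite plin pslin opprD scalerN.
Qed.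

Lemma normal_ordered_finitely_supported l v :
  finitely_supported (fun i => normal_ordered i (l - i) v).
Proof.
have [M hM] := fermion_locally_finite v.
apply: (@finitely_supported_interval _ _ (Num.min 0 (l - M)) (Num.max 0 M)) =>
  i hi.
  have [h0 hl] : i < 0 /\ M <= l - i by lia.
  by rewrite /normal_ordered h0; case: (hM _ hl) => _ ->; exact: linear0_of.
have [h0 hl] : (i < 0) = false /\ M <= i by lia.
by rewrite /normal_ordered h0; case: (hM _ hl) => -> _;
  rewrite linear0_of ?oppr0.
Qed.

Definition bilin (f : int -> K) (l : int) (v : V) : V :=
  \sum_(i \in [set: int]) f i *: normal_ordered i (l - i) v.

Lemma bilin_finitely_supported f l v :
  finitely_supported (fun i => f i *: normal_ordered i (l - i) v).
Proof. exact/finitely_supportedZ/normal_ordered_finitely_supported. Qed.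

Lemma bilin_linear f l : linear (bilin f l).
Proof.
move=> c x y; rewrite /bilin.
rewrite (fsum_morph (f := fun z => c *: z)) //;
  [|exact: scalerDr|exact: bilin_finitely_supported].
rewrite -fsumD; [|exact/finitely_supportedZ/bilin_finitely_supported|exact:
  bilin_finitely_supported].
apply: eq_fsumr => i; rewrite normal_ordered_linear scalerDr !scalerA.
by rewrite [f i * c]mulrC.
Qed.

Lemma bilin_comm_lin f l (g : V -> V) v : linear g ->
  bilin f l (g v) - g (bilin f l v) =
  \sum_(i \in [set: int]) f i *:
     (p i (ps (l - i) (g v)) - g (p i (ps (l - i) v))).
Proof.
move=> lg; have gD := linearD_of lg.
rewrite /bilin (fsum_morph gD) ?bilin_finitely_supported //;
  last exact: bilin_finitely_supported.
have oD : {morph (@GRing.opp V) : x y / x + y} by move=> x y; rewrite opprD.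
rewrite (fsum_morph oD); last exact/(finitely_supported_morph
  gD)/bilin_finitely_supported.
rewrite -fsumD; [|exact: bilin_finitely_supported
  |exact/(finitely_supported_morph oD)/(finitely_supported_morph
    gD)/bilin_finitely_supported].
apply: eq_fsumr => i; rewrite (linearZ_of _ _ lg) -scalerBr !normal_orderedE.
by rewrite gD (linearZ_of _ _ lg) opprD addrACA subrr addr0.
Qed.

Lemma bilin_psi f l r v :
  bilin f l (p r v) - p r (bilin f l v) = f (l + r) *: p (l + r) v.
Proof.
rewrite bilin_comm_lin //.
have E i : p i (ps (l - i) (p r v)) - p r (p i (ps (l - i) v)) =
    (i == l + r)%:R *: p i v.
  rewrite (fermion_pp fer r) opprK -(linearD_of (plin i)) (fermion_ps fer r)
    addrCA subrr addr0.
  by rewrite (linearZ_of _ _ (plin i)); congr (_%:R *: _); lia.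
rewrite (@fsum_single _ _ _ (l + r)) => [|i /negPf hi].
  by rewrite E eqxx scale1r.
by rewrite E hi scale0r scaler0.
Qed.

Lemma bilin_psis f l s v :
  bilin f l (ps s v) - ps s (bilin f l v) = - (f (- s) *: ps (l + s) v).
Proof.
rewrite bilin_comm_lin //.
have E i : p i (ps (l - i) (ps s v)) - ps s (p i (ps (l - i) v)) =
    - ((i == - s)%:R *: ps (l - i) v).
  rewrite (fermion_ss fer) (linearN_of _ (plin i)).
  have -> : ps s (p i (ps (l - i) v)) = (i == - s)%:R *: ps (l - i) v
      - p i (ps s (ps (l - i) v)).
    rewrite (fermion_ps fer i s) (_ : (i == - s) = (i + s == 0)); last by lia.
    by rewrite subKr.
  by rewrite opprB addrA addNr sub0r.
rewrite (@fsum_single _ _ _ (- s)) => [|i /negPf hi].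
  by rewrite E eqxx scale1r scalerN opprK.
by rewrite E hi scale0r oppr0 scaler0.
Qed.

End Fermions.

Section BilinearBracket.
Variables (K : fieldType) (V : lmodType K) (p ps : int -> V -> V) (v0 : V).
Hypothesis fer : fermions p ps v0.

Local Notation bilin := (bilin p ps).
Local Notation normal_ordered := (normal_ordered p ps).

Lemma bilin_normal_ordered f l a b v :
  bilin f l (normal_ordered a b v) - normal_ordered a b (bilin f l v) =
  f (l + a) *: p (l + a) (ps b v) - f (- b) *: p a (ps (l + b) v).
Proof.
have nE x : normal_ordered a b x =
    - ((a + b == 0) && (0 <= a))%:R *: x + p a (ps b x).
  by rewrite (normal_orderedE fer) addrCA scaleNr addNr addr0.
rewrite !nE (bilin_linear fer) opprD addrACA subrr add0r.
have -> : bilin f l (p a (ps b v)) =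
    f (l + a) *: p (l + a) (ps b v) + p a (bilin f l (ps b v)).
  by rewrite -(bilin_psi fer) subrK.
have -> : bilin f l (ps b v) =
    - (f (- b) *: ps (l + b) v) + ps b (bilin f l v).
  by rewrite -(bilin_psis fer) subrK.
rewrite -scaleNr (fermion_lin fer) scaleNr -addrA; congr (_ + _).
by rewrite addrK.
Qed.

Lemma eq_bilin f g l v : f =1 g -> bilin f l v = bilin g l v.
Proof. by move=> fg; apply: eq_fsumr => i; rewrite fg. Qed.

Lemma bilinZ c f l v : bilin (fun i => c * f i) l v = c *: bilin f l v.
Proof.
rewrite /bilin (fsum_morph (f := fun x => c *: x));
  last exact: (bilin_finitely_supported fer).
  by apply: eq_fsumr => i; rewrite scalerA.
exact: scalerDr.
Qed.

Definition step_difference (l i : int) : K := (0 <= l + i)%R%:R - (0 <= i)%R%:R.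

Lemma step_difference_finitely_supported l : finitely_supported
  (step_difference l).
Proof.
by apply: (@finitely_supported_interval _ _ (Num.min 0 (- l)) (Num.max 0 (-
  l))) => i hi;
  rewrite /step_difference (_ : (0 <= l + i) = (0 <= i)) ?subrr //; lia.
Qed.

(* The central term comes from restoring the normal ordering of p_(l+i)ps_(-l-i)
   and of p_i ps_(-i), which counts the signs of l+i and of i. *)
Lemma bilin_bracket f l g s v :
  bilin f l (bilin g s v) - bilin g s (bilin f l v) =
  bilin (fun i => f i * g (i - l) - g i * f (i - s)) (l + s) v
  + ((l + s == 0)%:R *
      (\sum_(i \in [set: int]) g i * f (l + i) * step_difference l i)) *: v.
Proof.
have fD := linearD_of (bilin_linear fer f l).
rewrite {1}/(bilin g) (fsum_morph fD);
  last exact: (bilin_finitely_supported fer).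
have oD : {morph (@GRing.opp V) : x y / x + y} by move=> x y; rewrite opprD.
rewrite {1}/(bilin g) (fsum_morph oD);
  last exact: (bilin_finitely_supported fer).
rewrite -fsumD; [|exact/(finitely_supported_morph fD)/(bilin_finitely_supported
  fer)
  |exact/(finitely_supported_morph oD)/(bilin_finitely_supported fer)].
pose A i := (f i * g (i - l)) *: normal_ordered i (l + s - i) v.
pose B i := - (g i * f (i - s)) *: normal_ordered i (l + s - i) v.
pose C i := ((l + s == 0)%:R * (g i * f (l + i) * step_difference l i)) *: v.
have finA : finitely_supported A by exact: (bilin_finitely_supported fer).
have finB : finitely_supported B by exact: (bilin_finitely_supported fer).
have finC : finitely_supported C.
  have [t ht] := step_difference_finitely_supported l.
  by exists t => i /ht e; rewrite /C e !mulr0 scale0r.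
transitivity (\sum_(i \in [set: int]) (A (l + i) + B i + C i)).
  apply: eq_fsumr => i.
  rewrite (linearZ_of _ _ (bilin_linear fer f l)) -scalerBr.
  rewrite bilin_normal_ordered !(normal_orderedE fer) /A /B /C.
  have -> : - (s - i) = i - s by lia.
  have -> : l + i - l = i by lia.
  have -> : l + s - (l + i) = s - i by lia.
  have -> : l + (s - i) = l + s - i by lia.
  have -> : (l + i + (s - i) == 0) = (l + s == 0) by lia.
  have -> : (i + (l + s - i) == 0) = (l + s == 0) by lia.
  rewrite scalerBr !scalerA !scalerDr !scalerA opprD addrACA -scalerBl -scaleNr.
  rewrite [f _ * g _]mulrC; congr (_ + _ + _ *: _).
  rewrite /step_difference; case: eqP => [e|_] /=;
    last by rewrite !(mulr0, mul0r) subrr.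
  have -> : i - s = l + i by lia.
  by rewrite !mul1r mulrBr.
rewrite fsumD //; last first.
  exact/finitely_supportedD/finB/finitely_supported_shift.
rewrite fsumD //; last exact: finitely_supported_shift.
rewrite fsum_shift; congr (_ + _).
  rewrite -fsumD //; apply: eq_fsumr => i.
  by rewrite /A /B -scalerDl.
have vD : {morph (fun c => c *: v) : x y / x + y} by move=> x y;
  rewrite scalerDl.
rewrite -(fsum_morph vD); last first.
  have [t ht] := step_difference_finitely_supported l.
  by exists t => i /ht e; rewrite e !mulr0.
rewrite -(@fsum_morph _ _ _ ( *%R _)) //; first exact: mulrDr.
have [t ht] := step_difference_finitely_supported l.
by exists t => i /ht e; rewrite e !mulr0.
Qed.

End BilinearBracket.

Section Telescope.
Variable K : fieldType.

Lemma step_differenceS l i :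
  step_difference K (l + 1) i = step_difference K l i + (i == - l - 1)%:R.
Proof.
have E : (0 <= l + 1 + i)%R%:R = (0 <= l + i)%R%:R + (i == - l - 1)%:R :> K.
  have [->|hi] := eqVneq; last by rewrite addr0; congr (_%:R); lia.
  have -> : (0 <= l + 1 + (- l - 1)) = true by lia.
  have -> : (0 <= l + (- l - 1)) = false by lia.
  by rewrite add0r.
by rewrite /step_difference E addrAC.
Qed.

Lemma fsum_step_difference (y : int -> K) l :
  \sum_(i \in [set: int]) (y (i + 1) - y i) * step_difference K l i =
    y 0 - y (- l).
Proof.
pose S l := \sum_(i \in [set: int]) (y (i + 1) - y i) * step_difference K l i.
have SS j : S (j + 1) = S j + (y (- j) - y (- j - 1)).
  rewrite /S; under eq_fsumr do rewrite step_differenceS mulrDr.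
  rewrite fsumD; last 2 first.
  - have [t ht] := step_difference_finitely_supported K j.
    by exists t => i /ht ->; rewrite mulr0.
  - by exists [fset (- j - 1)%R]%fset => i; rewrite in_fset1 => /negPf ->;
    rewrite mulr0.
  congr (_ + _); rewrite (@fsum_single _ _ _ (- j - 1)) => [|i /negPf ->].
    by rewrite eqxx mulr1 subrK.
  by rewrite mulr0.
rewrite -/(S l); elim/int_rect: l => [|n IH|n IH].
- by rewrite /S fsbig1 ?oppr0 ?subrr // => i _;
  rewrite /step_difference add0r subrr mulr0.
- rewrite -addn1 PoszD SS IH addrA subrK; congr (_ - y _); lia.
- have := SS (- n.+1%:Z); rewrite (_ : - n.+1%:Z + 1 = - n%:Z) ?IH; last by lia.
  rewrite !opprK (_ : n.+1%:Z - 1 = n%:Z); last by lia.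
  by move/(canLR (addrK _)) <-; rewrite opprB addrA subrK.
Qed.

End Telescope.

Section FractionalPowers.
Variables (K : fieldType) (q : K) (qp : rat -> K).
Hypotheses (q0 : q != 0) (hqp : fractional_powers q qp).

Lemma fpowD r s : qp (r + s) = qp r * qp s.
Proof. by case: hqp. Qed.

Lemma fpow_neq0 r : qp r != 0.
Proof.
apply: contra q0 => /eqP h; case: hqp => <- hD.
by rewrite -[1](subrK r) hD h mulr0.
Qed.

Lemma fpow0 : qp 0 = 1.
Proof.
by apply: (mulfI (fpow_neq0 0)); rewrite -fpowD addr0 mulr1.
Qed.

Lemma fpowN r : qp (- r) = (qp r)^-1.
Proof.
by apply: (mulfI (fpow_neq0 r)); rewrite -fpowD subrr fpow0 mulfV ?fpow_neq0.
Qed.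

Lemma fpowMz r (k : int) : qp (r * k%:~R) = qp r ^ k.
Proof.
have h n : qp (r * n%:R) = qp r ^+ n.
  elim: n => [|n IH]; first by rewrite mulr0 fpow0.
  by rewrite -addn1 natrD mulrDr mulr1 fpowD IH exprD expr1.
by case: k => n; [exact: h|rewrite NegzE rmorphN mulrN fpowN h exprnN].
Qed.

Lemma fpow_int_eq1 (k : int) : not_root_of_unity q ->
  (qp k%:~R == 1) = (k == 0).
Proof.
move=> hq; have [->|k0] := eqVneq k 0; first by rewrite fpow0 eqxx.
rewrite -[k%:~R]mul1r fpowMz; case: hqp => -> _.
case: k k0 => n; first by rewrite -lt0n => /hq /negPf.
by move=> _; rewrite NegzE -exprnN invr_eq1; move: (hq n.+1 isT) => /negPf.
Qed.

End FractionalPowers.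

(** * The representation on an abstract fermion system *)

Section VertexOperators.
Variables (K : fieldType) (q : K) (qp : rat -> K) (u : K).
Hypotheses (q0 : q != 0) (hq : not_root_of_unity q).
Hypotheses (hqp : fractional_powers q qp) (u0 : u != 0).
Variables (V : lmodType K) (p ps : int -> V -> V) (v0 : V).
Hypothesis fer : fermions p ps v0.

Local Notation bilin := (bilin p ps).

Definition fpow_weight (k l i : int) : K := qp ((k * (2 * i - l))%:~R / 2).

(* 0 for k = l = 0, where the denominator vanishes; E_{0,0} is not a generator
   and this value never matters. *)
Definition vertex_constant (k l : int) : K := (l == 0)%:R / (1 - qp k%:~R).

Definition vertex_op (k l : int) (v : V) : V :=
  u ^ k *: (bilin (fpow_weight k l) l v + vertex_constant k l *: v).

Lemma vertex_op_linear k l : linear (vertex_op k l).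
Proof.
move=> c x y; rewrite /vertex_op (bilin_linear fer) !scalerDr !scalerA.
rewrite addrACA; congr (_ *: _ + _ *: _ + _); ring.
Qed.

Lemma fpow_weight_cocycle k l r :
  \sum_(i \in [set: int]) fpow_weight r (- l) i * fpow_weight k l (l + i)
    * step_difference K l i =
  (qp ((- (l * (k + r)))%:~R / 2) - qp ((l * (k + r))%:~R / 2))
    / (1 - qp (k + r)%:~R) + (if k == - r then l%:~R else 0).
Proof.
set d := k + r.
have E i : fpow_weight r (- l) i * fpow_weight k l (l + i) =
    qp ((d * (2 * i + l))%:~R / 2).
  by rewrite /fpow_weight -(fpowD hqp) /d; congr (qp _); field.
under eq_fsumr do rewrite E.
have hd : (k == - r) = (d == 0) by rewrite /d; lia.
rewrite hd; case: eqP => [->|/eqP d0].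
  rewrite mulr0 oppr0 subrr mul0r add0r.
  transitivity (\sum_(i \in [set: int]) ((i + 1)%:~R - i%:~R) * step_difference
    K l i).
    apply: eq_fsumr => i; rewrite mul0r mul0r (fpow0 q0 hqp) rmorphD /=.
    by rewrite addrAC subrr add0r.
  rewrite (fsum_step_difference (fun i => i%:~R)).
  by rewrite rmorphN /= opprK add0r.
have d1 : 1 - qp d%:~R != 0 by rewrite subr_eq0 eq_sym (fpow_int_eq1 q0 hqp).
(* The sum is geometric, hence telescoping. *)
pose y i := - (qp ((d * (2 * i + l))%:~R / 2) / (1 - qp d%:~R)).
transitivity (\sum_(i \in [set: int]) (y (i + 1) - y i) * step_difference K l
  i).
  apply: eq_fsumr => i; congr (_ * _); rewrite /y.
  have -> : (d * (2 * (i + 1) + l))%:~R / 2 = (d * (2 * i + l))%:~R / 2 + d%:~R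
    :> rat.
    by field.
  by rewrite (fpowD hqp); field.
rewrite fsum_step_difference addr0 /y.
have -> : d * (2 * 0 + l) = l * d by ring.
have -> : d * (2 * (- l) + l) = - (l * d) by ring.
by field.
Qed.

Lemma vertex_op_bracket k l r s v :
  vertex_op k l (vertex_op r s v) - vertex_op r s (vertex_op k l v) =
  (qp ((s * k - l * r)%:~R / 2) - qp ((l * r - s * k)%:~R / 2))
    *: vertex_op (k + r) (l + s) v
  + (if (k == - r) && (l == - s) then l%:~R *: v else 0).
Proof.
have sC (x y : K) (w : V) : x *: (y *: w) = y *: (x *: w).
  by rewrite !scalerA mulrC.
have lin (a b c d : K) (f g : V -> V) : linear f -> linear g ->
    a *: (f (b *: (g v + d *: v)) + c *: (b *: (g v + d *: v)))
    - b *: (g (a *: (f v + c *: v)) + d *: (a *: (f v + c *: v))) =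
    (a * b) *: (f (g v) - g (f v)).
  move=> lf lg; rewrite !(linearZ_of _ _ lf) !(linearZ_of _ _ lg).
  rewrite !(linearD_of lf) !(linearD_of lg) !(linearZ_of _ _ lf) !(linearZ_of _
    _ lg).
  rewrite [c *: (b *: _)]sC [d *: (a *: _)]sC -!scalerDr !scalerA.
  rewrite [b * a]mulrC -scalerBr; congr (_ *: _).
  rewrite !scalerDr !scalerA [d * c]mulrC (addrACA (g (f v))).
  by rewrite opprD addrACA subrr addr0 opprD addrACA subrr addr0.
rewrite /vertex_op lin; [|exact: bilin_linear fer _ _..].
rewrite -expfzDr // (bilin_bracket fer).
set c := qp _ - qp _.
have -> : bilin (fun i => fpow_weight k l i * fpow_weight r s (i - l) -
      fpow_weight r s i * fpow_weight k l (i - s)) (l + s) v =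
    c *: bilin (fpow_weight (k + r) (l + s)) (l + s) v.
  rewrite -(bilinZ fer); apply: eq_bilin => i.
  rewrite /c /fpow_weight mulrBl -!(fpowD hqp).
  by congr (qp _ - qp _); field.
rewrite [c *: (_ *: _)]sC !scalerDr -addrA; congr (_ + _).
rewrite /vertex_constant; have [ls|ls] := eqVneq (l + s) 0; last first.
  rewrite !mul0r !scale0r !scaler0 add0r ifF //; lia.
have -> : s = - l by lia.
rewrite fpow_weight_cocycle.
have -> : c = qp ((- (l * (k + r)))%:~R / 2) - qp ((l * (k + r))%:~R / 2).
  by rewrite /c; congr (qp (_%:~R / _) - qp (_%:~R / _)); lia.
rewrite opprK eqxx andbT !mul1r scalerDl scalerDr !scalerA.
rewrite mulrA; congr (_ + _).
have [->|_] := eqVneq k (- r); last by rewrite mulr0 scale0r.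
by rewrite addNr expr0z mul1r.
Qed.

End VertexOperators.

Section Representation.
Variables (K : fieldType) (q : K) (qp : rat -> K) (u : K).
Hypotheses (q0 : q != 0) (hq : not_root_of_unity q).
Hypotheses (hqp : fractional_powers q qp) (u0 : u != 0).
Variables (V : lmodType K) (p ps : int -> V -> V) (v0 : V).
Hypothesis fer : fermions p ps v0.

Definition diff_rep_basis (v : V) (x : diff_index) : V :=
  match x with
  | inl r => let: (k, l) := val r in vertex_op qp u p ps k l v
  | inr true => v
  | inr false => 0
  end.

Definition diff_rep (x : diff K) (v : V) : V := lext (diff_rep_basis v) x.

Lemma diff_rep_linearl v : linear (diff_rep ^~ v).
Proof. by move=> a x y; rewrite /diff_rep linearP. Qed.

Lemma diff_rep_linearr x : linear (diff_rep x).
Proof.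
move=> a v w; rewrite /diff_rep /lext scaler_sumr -big_split /=.
apply: eq_bigr => i _; rewrite scalerA mulrC -scalerA -scalerDr; congr (_ *: _).
case: i => [[[k l] h]|[]] //=; last by rewrite scaler0 addr0.
exact: (vertex_op_linear qp u fer).
Qed.

Lemma diff_rep_dE k l v :
  (k, l) != (0, 0) -> diff_rep (dE K k l) v = vertex_op qp u p ps k l v.
Proof. by move=> kl; rewrite (dE_neq0 _ kl) /diff_rep lextU. Qed.

Lemma diff_rep_c v : diff_rep (dc K) v = v.
Proof. by rewrite /diff_rep lextU. Qed.

Lemma diff_rep_c' v : diff_rep (dc' K) v = 0.
Proof. by rewrite /diff_rep lextU. Qed.

Lemma diff_rep_central a b v : diff_rep (a *: dc' K + b *: dc K) v = b *: v.
Proof.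
rewrite diff_rep_linearl diff_rep_c' scaler0 add0r.
by rewrite (linearZ_of _ _ (diff_rep_linearl v)) diff_rep_c.
Qed.

Lemma diff_rep_dE00 v : diff_rep (dE K 0 0) v = 0.
Proof. by rewrite dE00; exact: linear0_of (diff_rep_linearl v). Qed.

Lemma diff_rep_action : diff_action qp diff_rep.
Proof.
split; [exact: diff_rep_linearl|exact: diff_rep_linearr|move=> x y v].
have ll := diff_rep_linearl; have lr := diff_rep_linearr.
have lc z w : linear (fun x => diff_rep x (diff_rep z w) - diff_rep z (diff_rep
  x w)).
  move=> a x' y'; rewrite !ll lr opprD -!scalerN !scalerDr !scalerN.
  by rewrite addrACA.
have lc' z w : linear (fun x => diff_rep z (diff_rep x w) - diff_rep x
  (diff_rep z w)).
  by move=> a x' y'; rewrite -opprB lc opprD -scalerN !opprB.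
move: x; apply: diff_ext.
- exact: linear_comp_fun (ll v) (linear_diff_bracketl qp y).
- exact: lc.
- move=> k l; move: y; apply: diff_ext.
  + exact: linear_comp_fun (ll v) (linear_diff_bracketr qp (dE K k l)).
  + exact: lc'.
  + move=> r s.
    have [[-> ->]|kl] := eqVneq (k, l) (0, 0).
      by rewrite !diff_rep_dE00 dE00 bracket0l !(linear0_of (ll _)) (linear0_of
        (lr _)) subrr.
    have [[-> ->]|rs] := eqVneq (r, s) (0, 0).
      by rewrite !diff_rep_dE00 dE00 bracket0r !(linear0_of (ll _)) (linear0_of
        (lr _)) subrr.
    rewrite diff_bracket_dE !diff_rep_dE // (vertex_op_bracket q0 hq hqp u0
      fer).
    rewrite ll; congr (_ + _).
      have [[e1 e2]|?] := eqVneq (k + r, l + s) (0, 0);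
        last by rewrite diff_rep_dE.
      have -> : s * k - l * r = 0 by nia.
      have -> : l * r - s * k = 0 by nia.
      by rewrite subrr !scale0r.
    case: ifP => _; last exact: linear0_of (ll v).
    by rewrite ll diff_rep_c' scaler0 add0r (linearZ_of _ _ (ll v)) diff_rep_c.
  + by rewrite diff_bracket_cr !diff_rep_c subrr (linear0_of (ll v)).
  + by rewrite diff_bracket_c'r !diff_rep_c' (linear0_of (lr _)) subrr
    (linear0_of (ll v)).
- by rewrite diff_bracket_cl !diff_rep_c subrr (linear0_of (ll v)).
- by rewrite diff_bracket_c'l !diff_rep_c' (linear0_of (lr _)) subrr
  (linear0_of (ll v)).
Qed.

End Representation.

Lemma diff_rep_intertwine (K : fieldType) (qp : rat -> K) (u : K)
    (V W : lmodType K) (p ps : int -> V -> V) (p' ps' : int -> W -> W) v0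
    (f : V -> W) x v :
  fermions p ps v0 -> linear f ->
  (forall i v, f (p i v) = p' i (f v)) ->
  (forall i v, f (ps i v) = ps' i (f v)) ->
  f (diff_rep qp u p ps x v) = diff_rep qp u p' ps' x (f v).
Proof.
move=> fer lf hp hps; have fD := linearD_of lf.
move: x; apply: lext_eq.
- exact: linear_comp_fun lf (diff_rep_linearl qp u p ps v).
- exact: diff_rep_linearl.
move=> i; rewrite /diff_rep !lextU; case: i => [[[k l] h]|[]] //=;
  last exact: linear0_of.
rewrite /vertex_op (linearZ_of _ _ lf) fD (linearZ_of _ _ lf).
congr (_ *: (_ + _)); rewrite /bilin (fsum_morph fD);
  last exact: bilin_finitely_supported fer _ _ _.
apply: eq_fsumr => i; rewrite (linearZ_of _ _ lf); congr (_ *: _).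
by rewrite /normal_ordered; case: ifP => _;
  rewrite ?(linearN_of _ lf) !(hp, hps).
Qed.

(** * The fermion space *)

Lemma malg_monomialE (I : choiceType) (K : nzRingType) (c : K) (m : I) :
  << c *g m >> = c *: << m >> :> {malg K[I]}.
Proof.
apply/malgP => j; rewrite mcoeffZ !mcoeffU.
by case: (m == j); rewrite ?mulr1n ?mulr0n ?mulr1 ?mulr0.
Qed.

Lemma malg_scalerAr (I : monomType) (K : comNzRingType) (a : K)
    (x y : {malg K[I]}) : x * (a *: y) = a *: (x * y).
Proof.
have C : x * a%:MP%R = a%:MP%R * x.
  rewrite !malgM_def fgmulgU fgmulUg; apply: eq_bigr => k _.
  by rewrite mulrC mulm1 mul1m.
by rewrite -(mul_malgC a y) mulrA C -mulrA mul_malgC.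
Qed.

Section FreeAlgebraAction.
Variables (K : fieldType) (n : nat) (W : lmodType K).
Variable op : letter n -> W -> W.
Hypothesis op_linear : forall x, linear (op x).

Definition word_act (m : {fmonom letter n}) (w : W) : W := foldr op w m.

Definition free_act (x : free_alg K n) (w : W) : W :=
  lext (word_act ^~ w) x.

Lemma word_act_linear m : linear (word_act m).
Proof.
move=> a v w; rewrite /word_act; elim: (m : seq _) => //= y s ->.
exact: op_linear.
Qed.

Lemma free_act_linearl w : linear (free_act ^~ w).
Proof. by move=> a x y; rewrite /free_act linearP. Qed.

Lemma free_act_linearr x : linear (free_act x).
Proof.
move=> a v w; rewrite /free_act /lext scaler_sumr -big_split /=.
apply: eq_bigr => i _; rewrite scalerA mulrC -scalerA -scalerDr; congr (_ *: _).
exact: word_act_linear.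
Qed.

Lemma free_mul_linearl (y : free_alg K n) : linear (fun x : free_alg K n => x *
  y).
Proof. by move=> a x x'; rewrite mulrDl scalerAl. Qed.

Lemma free_mul_linearr (x : free_alg K n) : linear (fun y : free_alg K n => x *
  y).
Proof.
move=> a y y'; rewrite mulrDr; congr (_ + _).
exact: malg_scalerAr.
Qed.

Lemma free_actM x y w : free_act (x * y) w = free_act x (free_act y w).
Proof.
move: x; apply: lext_eq.
- exact: linear_comp_fun (free_act_linearl w) (free_mul_linearl y).
- exact: free_act_linearl.
move=> i; move: y; apply: lext_eq.
- exact: linear_comp_fun (free_act_linearl w) (free_mul_linearr _).
- exact: linear_comp_fun (free_act_linearr _) (free_act_linearl w).
move=> j; rewrite malgM_def fgmulUU mulr1 /free_act !lextU /word_act.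
by rewrite fmM foldr_cat.
Qed.

Lemma free_act1 w : free_act 1 w = w.
Proof. by rewrite /free_act lextU /word_act fm1. Qed.

Lemma free_act_letter x w : free_act << fmu x >> w = op x w.
Proof. by rewrite /free_act lextU /word_act fmU. Qed.

Lemma free_act_anticomm_letters x y w :
  free_act (anticomm << fmu x >> << fmu y >>) w =
    op x (op y w) + op y (op x w).
Proof.
apply: etrans (linearD_of (free_act_linearl w) _ _) _.
by congr (_ + _); apply: etrans (free_actM _ _ _) _; rewrite !free_act_letter.
Qed.

Lemma free_actB_nat x (k : nat) w :
  free_act (x - k%:R) w = free_act x w - k%:R *: w.
Proof.
apply: etrans (linearB_of (free_act_linearl w) _ _) _.
rewrite -scaler_nat; congr (_ - _).
by apply: etrans (linearZ_of _ _ (free_act_linearl w)) _; rewrite free_act1.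
Qed.

Lemma free_act_fock_relation (w0 : W) :
  (forall r w, clifford_relator r -> free_act r w = 0) ->
  (forall r, annihilator r -> free_act r w0 = 0) ->
  forall x, fock_relation x -> free_act x w0 = 0.
Proof.
move=> hC hA x; elim=> [|y z _ hy _ hz|y r z hr|y r hr].
- exact: linear0_of (free_act_linearl w0).
- by rewrite (linearD_of (free_act_linearl w0)) hy hz addr0.
- by rewrite !free_actM (hC r) // (linear0_of (free_act_linearr y)).
- by rewrite free_actM (hA r) // (linear0_of (free_act_linearr y)).
Qed.

End FreeAlgebraAction.

Section FockModes.
Variables (K : fieldType) (n0 : nat).
Local Notation n := n0.+1.

Lemma fock_piP a (x y : free_alg K n) :
  fock_pi (a *: x + y) = a *: (fock_pi x : fock K n) + fock_pi y.
Proof. by rewrite fock_piD -fock_scale_pi. Qed.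

Lemma fock_pi_linear : linear (fun x : free_alg K n => fock_pi x : fock K n).
Proof. exact: fock_piP. Qed.

Lemma fock_act_linear (x : free_alg K n) : linear (fock_act x).
Proof.
suff h a y z : fock_act x (a *: (fock_pi y : fock K n) + (fock_pi z : fock K
  n)) =
    a *: fock_act x (fock_pi y : fock K n) + fock_act x (fock_pi z : fock K n).
  by move=> a v w; rewrite -[v]fock_reprK -[w]fock_reprK h.
apply: (etrans (congr1 (fock_act x) (esym (fock_piP a y z)))).
apply: (etrans (fock_act_pi x (a *: y + z))).
rewrite (fock_act_pi x y) (fock_act_pi x z).
apply: etrans (fock_piP a (x * y) (x * z)); congr fock_pi.
exact: free_mul_linearr.
Qed.

Lemma fock_pi_eq0 (x : free_alg K n) : fock_relation x -> fock_pi x = 0.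
Proof.
move=> hx; have -> : 0 = fock_pi 0 :> fock K n by rewrite -[0 in RHS](subrr 0)
  fock_piB subrr.
by apply/eqP; rewrite fock_piE subr0; apply/fock_idealP.
Qed.

Definition residue (i : int) : 'I_n := inord (absz (i %% n%:Z)%Z).

(* psi_(ni+a) = psi_(a)[i] and psi^*_(nj-b) = psi^*_(b)[j]. *)
Definition psi_mode (i : int) : fock K n -> fock K n :=
  psi (residue i) (i %/ n%:Z)%Z.
Definition psis_mode (j : int) : fock K n -> fock K n :=
  psis (residue (- j)) (- (- j %/ n%:Z)%Z).

Lemma residueE i : (residue i)%:Z = (i %% n%:Z)%Z.
Proof. by rewrite /residue inordK; lia. Qed.

Lemma residueMD (a : 'I_n) i : residue (n%:Z * i + a%:Z) = a.
Proof.
apply: val_inj; rewrite /= /residue inordK mulrC modzMDl modz_small //;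
  have := ltn_ord a; lia.
Qed.

Lemma divzMDord (a : 'I_n) i : ((n%:Z * i + a%:Z) %/ n%:Z)%Z = i.
Proof.
by rewrite mulrC divzMDl // divz_small ?addr0 //; have := ltn_ord a; lia.
Qed.

Lemma psi_modeE (a : 'I_n) i : psi_mode (n%:Z * i + a%:Z) = psi a i.
Proof. by rewrite /psi_mode residueMD divzMDord. Qed.

Lemma psis_modeE (b : 'I_n) j : psis_mode (n%:Z * j - b%:Z) = psis b j.
Proof.
rewrite /psis_mode (_ : - _ = n%:Z * (- j) + b%:Z); last by ring.
by rewrite residueMD divzMDord opprK.
Qed.

Lemma residue_eqP i j :
  (residue i == residue (- j)) && ((i %/ n%:Z)%Z + - (- j %/ n%:Z)%Z == 0)
  = (i + j == 0).
Proof.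
apply/andP/eqP => [[/eqP hr /eqP hd]|h]; last first.
  have -> : - j = i by lia.
  by rewrite subrr; split.
have := congr1 (fun x : 'I_n => x%:Z) hr; rewrite !residueE => hm.
have e1 := divz_eq i n%:Z; have e2 := divz_eq (- j) n%:Z.
by rewrite hm (_ : (i %/ n%:Z)%Z = (- j %/ n%:Z)%Z) in e1; lia.
Qed.

Lemma fock_relator_act (r : free_alg K n) (v : fock K n) :
  clifford_relator r -> fock_act r v = 0.
Proof.
move=> hr; rewrite -[v]fock_reprK fock_act_pi; apply: fock_pi_eq0.
by rewrite -[r]mul1r; exact: fock_rel_cliff.
Qed.

Lemma fock_actD (x y : free_alg K n) v :
  fock_act (x + y) v = fock_act x v + fock_act y v.
Proof. by rewrite /fock_act mulrDl fock_piD. Qed.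

Lemma fock_actB (x y : free_alg K n) v :
  fock_act (x - y) v = fock_act x v - fock_act y v.
Proof. by rewrite /fock_act mulrBl fock_piB. Qed.

Lemma fock_actM (x y : free_alg K n) v :
  fock_act (x * y) v = fock_act x (fock_act y v).
Proof. by rewrite -[v]fock_reprK !fock_act_pi mulrA. Qed.

Lemma fock_act_anticomm (x y : free_alg K n) v :
  fock_act (anticomm x y) v =
    fock_act x (fock_act y v) + fock_act y (fock_act x v).
Proof.
apply: etrans (fock_actD (x * y) (y * x) v) _.
exact: (congr2 +%R (fock_actM x y v) (fock_actM y x v)).
Qed.

Lemma fock_act_nat (k : nat) (v : fock K n) : fock_act k%:R v = k%:R *: v.
Proof.
rewrite -[v]fock_reprK fock_act_pi mulr_natl -scaler_nat.
by rewrite -fock_scale_pi.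
Qed.

Lemma fock_fermions : fermions psi_mode psis_mode (vac K n).
Proof.
split.
- by move=> i; exact: fock_act_linear.
- by move=> i; exact: fock_act_linear.
- move=> i j v; apply/eqP; rewrite -addr_eq0; apply/eqP.
  exact: etrans (esym (fock_act_anticomm _ _ v)) (fock_relator_act v
    (rel_psi_psi K _ _ _ _)).
- move=> i j v; apply/eqP; rewrite -addr_eq0; apply/eqP.
  exact: etrans (esym (fock_act_anticomm _ _ v)) (fock_relator_act v
    (rel_psis_psis K _ _ _ _)).
- move=> i j v; apply/eqP; rewrite eq_sym subr_eq -subr_eq0 -opprB oppr_eq0;
  apply/eqP.
  rewrite -residue_eqP -fock_act_nat -fock_act_anticomm -fock_actB.
  exact: fock_relator_act v (rel_psi_psis K _ _ _ _).
- move=> i hi; rewrite /psi_mode /psi /vac fock_act_pi; apply: fock_pi_eq0.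
  rewrite mulr1 -[gpsi _ _ _]mul1r; apply/fock_rel_ann/ann_psi.
  by rewrite divz_ge0.
- move=> j hj; rewrite /psis_mode /psis /vac fock_act_pi; apply: fock_pi_eq0.
  rewrite mulr1 -[gpsis _ _ _]mul1r; apply/fock_rel_ann/ann_psis.
  by rewrite oppr_gt0 ltz_divLR // mul0r oppr_lt0.
move=> P P0 PD Pp Pps x; rewrite -[x]fock_reprK; set y := repr x.
have P00 : P 0 by rewrite -[0](addNr (vac K n)) -scaleN1r; exact: PD.
rewrite [y]monalgE.
rewrite (big_morph _ (linearD_of fock_pi_linear) (linear0_of fock_pi_linear)).
apply: (big_ind P) => // [z z' Pz Pz'|m _]; first by rewrite -[z]scale1r;
  exact: PD.
rewrite malg_monomialE (linearZ_of _ _ fock_pi_linear) -[_ *: _]addr0.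
apply: (PD) => //; case: m => s; elim: s => [|a s IH].
  by rewrite -fmoneE.
have -> : << FMonom (a :: s) >> = << fmu a >> * << FMonom s >> :> free_alg K n.
  rewrite malgM_def fgmulUU mulr1; congr << _ >>.
  by apply: val_inj; rewrite /= fmM fmU.
rewrite -fock_act_pi; case: a => -[a i].
  by rewrite -/(gpsi _ _ _) -/(psi _ _ _) -psi_modeE; exact: Pp.
by rewrite -/(gpsis _ _ _) -/(psis _ _ _) -psis_modeE; exact: Pps.
Qed.

Lemma fock_fermion_map (W : lmodType K) (p ps : int -> W -> W) (w0 : W) :
  fermions p ps w0 -> exists f : fock K n -> W,
  [/\ linear f, f (vac K n) = w0,
      forall i v, f (psi_mode i v) = p i (f v)
    & forall j v, f (psis_mode j v) = ps j (f v)].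
Proof.
move=> fer.
pose op (x : letter n) : W -> W := match x with
  | inl (a, i) => p (n%:Z * i + a%:Z) | inr (b, j) => ps (n%:Z * j - b%:Z) end.
have op_lin x : linear (op x).
  by case: x => -[a i]; [exact: (fermion_lin fer)|exact: (fermions_lin fer)].
have ll := free_act_linearl op; have lr := free_act_linearr op_lin.
have kill : forall x, fock_relation x -> free_act op x w0 = 0.
  apply: (free_act_fock_relation op_lin) => [r w|r].
    case=> [a i b j|a i b j|a i b j].
    - apply: etrans (free_act_anticomm_letters op_lin _ _ w) _.
      by rewrite /= (fermion_pp fer) addNr.
    - apply: etrans (free_act_anticomm_letters op_lin _ _ w) _.
      by rewrite /= (fermion_ss fer) addNr.
    apply: etrans (free_actB_nat op _ _ w) _; apply/eqP; rewrite subr_eq0.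
    apply/eqP/(etrans (free_act_anticomm_letters op_lin _ _ w)).
    rewrite /= (fermion_ps fer) subrK; congr (_%:R *: _).
    have := ltn_ord a; have := ltn_ord b => hb ha.
    congr nat_of_bool; apply/idP/idP => [/eqP h|/andP[/eqP -> /eqP h]];
      last first.
      by apply/eqP; rewrite -[RHS](mulr0 n%:Z) -h; ring.
    have ij : i + j = 0 by nia.
    by rewrite ij eqxx andbT; apply/eqP/val_inj => /=; nia.
  by case=> [a i hi|b j hj]; rewrite free_act_letter /=;
    [apply: (fermion_ann fer)|apply: (fermions_ann fer); have := ltn_ord b];
      nia.
pose f (v : fock K n) := free_act op (repr v) w0.
have fE x : f (fock_pi x) = free_act op x w0.
  apply/eqP; rewrite -subr_eq0 -(linearB_of (ll w0)); apply/eqP/kill.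
  by apply/fock_idealP; rewrite -fock_piE fock_reprK.
have fact x v : f (fock_act x v) = free_act op x (f v).
  by rewrite -[v]fock_reprK fock_act_pi !fE free_actM.
exists f; split.
- suff h c y z : f (c *: (fock_pi y : fock K n) + (fock_pi z : fock K n)) =
      c *: f (fock_pi y) + f (fock_pi z).
    by move=> c v w; rewrite -[v]fock_reprK -[w]fock_reprK h.
  by rewrite -(fock_pi_linear c y z) (fE y) (fE z) fE ll.
- by rewrite fE free_act1.
- move=> i v; rewrite fact free_act_letter /= residueE [_ * _]mulrC.
  by rewrite -divz_eq.
- move=> j v; rewrite fact free_act_letter /= residueE mulrN [_ * _]mulrC.
  by rewrite -opprD -divz_eq opprK.
Qed.

End FockModes.

Lemma scaled_fermions (K : fieldType) (V : lmodType K) (p ps : int -> V -> V)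
    (v0 : V) (lam : int -> K) :
  fermions p ps v0 -> (forall i, lam i != 0) ->
  fermions (fun i v => lam i *: p i v) (fun j v => (lam (- j))^-1 *: ps j v) v0.
Proof.
move=> fer lam0; have pl := fermion_lin fer; have psl := fermions_lin fer.
split.
- by move=> i c x y; rewrite pl scalerDr !scalerA mulrC.
- by move=> i c x y; rewrite psl scalerDr !scalerA mulrC.
- move=> i j v; rewrite (linearZ_of _ _ (pl i)) (linearZ_of _ _ (pl j)).
  by rewrite (fermion_pp fer) !scalerN !scalerA mulrC.
- move=> i j v; rewrite (linearZ_of _ _ (psl i)) (linearZ_of _ _ (psl j)).
  by rewrite (fermion_ss fer) !scalerN !scalerA mulrC.
- move=> i j v; rewrite (linearZ_of _ _ (pl i)) (linearZ_of _ _ (psl j)).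
  rewrite (fermion_ps fer) !scalerBr !scalerA; congr (_ *: _ - _ *: _);
    last by rewrite mulrC.
  have [ij|_] := eqVneq (i + j) 0; last by rewrite mulr0.
  by rewrite (_ : - j = i) ?mulr1 ?divff //; lia.
- by move=> i hi; rewrite (fermion_ann fer) // scaler0.
- by move=> i hi; rewrite (fermions_ann fer) // scaler0.
move=> P P0 PD Pp Pps; have P00 : P 0 by rewrite -(addNr v0) -scaleN1r;
  exact: PD.
have PZ c x : P x -> P (c *: x) by move=> ?; rewrite -[_ *: _]addr0; exact: PD.
apply: (fermion_ind fer) => // i x /[dup] Px.
  by move/(Pp i)/(PZ (lam i)^-1); rewrite scalerA mulVf // scale1r.
by move/(Pps i)/(PZ (lam (- i))); rewrite scalerA mulfV // scale1r.
Qed.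

Lemma normal_ordered_scaled (K : fieldType) (V : lmodType K)
    (p ps : int -> V -> V) (v0 : V) (lam : int -> K) i j v :
  fermions p ps v0 ->
  normal_ordered (fun i v => lam i *: p i v)
    (fun j v => (lam (- j))^-1 *: ps j v) i j v =
  (lam i / lam (- j)) *: normal_ordered p ps i j v.
Proof.
move=> fer; rewrite /normal_ordered; case: ifP => _.
  by rewrite (linearZ_of _ _ (fermion_lin fer i)) scalerA.
by rewrite (linearZ_of _ _ (fermions_lin fer j)) scalerA scalerN mulrC.
Qed.

Section ResidueSum.
Variable n0 : nat.
Local Notation n := n0.+1.

Lemma fsum_big (V : zmodType) (I J : choiceType) (r : seq J) (F : J -> I -> V) :
  (forall a, finitely_supported (F a)) ->
  finitely_supported (fun i => \sum_(a <- r) F a i) /\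
  \sum_(i \in [set: I]) \sum_(a <- r) F a i =
    \sum_(a <- r) \sum_(i \in [set: I]) F a i.
Proof.
move=> hF; elim: r => [|a r [IH1 IH2]].
  split; first by exists fset0 => i _; rewrite big_nil.
  by rewrite big_nil fsbig1 // => i _; rewrite big_nil.
rewrite big_cons -IH2 -fsumD //; split; last first.
  by apply: eq_fsumr => i; rewrite big_cons.
have [s hs] := finitely_supportedD (hF a) IH1.
by exists s => i /hs; rewrite big_cons.
Qed.

Lemma fsum_residue (V : zmodType) (F : int -> V) : finitely_supported F ->
  \sum_(i \in [set: int]) F i =
    \sum_(a < n) \sum_(i \in [set: int]) F (n%:Z * i + a%:Z).
Proof.
move=> [s hs].
transitivity (\sum_(i \in [set: int]) \sum_(a < n)
    if residue n0 i == a then F i else 0).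
  apply: eq_fsumr => i; rewrite -big_mkcond.
  by rewrite (big_pred1 (residue n0 i)) // => a; rewrite /= eq_sym.
have [a|_ ->] := @fsum_big V _ _ (index_enum 'I_n)
  (fun a i => if residue n0 i == a then F i else 0).
  by exists s => i /hs ->; rewrite if_same.
apply: eq_bigr => a _.
rewrite -(@reindex_fsbig _ _ _ _ _ (fun i => n%:Z * i + a%:Z) setT
  [set i | residue n0 i == a]%classic).
  rewrite fsbig_mkcond; apply: eq_fsumr => i.
  have E : (i \in [set j | residue n0 j == a]%classic) = (residue n0 i == a).
    by apply/idP/idP => [/set_mem //|h]; exact: mem_set.
  by rewrite /patch E.
split.
- by move=> i _ /=; rewrite residueMD.
- by move=> i j _ _ h; nia.
- move=> i /= /eqP <-; exists (i %/ n%:Z)%Z => //.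
  by rewrite residueE mulrC -divz_eq.
Qed.

End ResidueSum.

(** * The twisted currents *)

Lemma fsum_affine (K : fieldType) (V : lmodType K) (J : finType) (w : V)
    (c D : J -> K) (C : J -> int -> K) (X : J -> int -> V) :
  (forall a, finitely_supported (X a)) ->
  \sum_a c a *: (D a *: w + \sum_(i \in [set: int]) C a i *: X a i) =
  \sum_a (\sum_(i \in [set: int]) (c a * C a i) *: X a i)
    + (\sum_a c a * D a) *: w.
Proof.
move=> hX; rewrite scaler_suml -big_split; apply: eq_bigr => a _.
rewrite scalerDr scalerA addrC; congr (_ + _).
rewrite (fsum_morph (f := fun v => c a *: v)).
- by apply: eq_fsumr => i; rewrite scalerA.
- exact: scalerDr.
- exact/finitely_supportedZ/hX.
Qed.

Lemma bilin_residue (K : fieldType) (V : lmodType K) (p ps : int -> V -> V)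
    (v0 : V) (n0 : nat) f l w : fermions p ps v0 ->
  bilin p ps f l w =
  \sum_(a < n0.+1) \sum_(i \in [set: int]) f (n0.+1%:Z * i + a%:Z) *:
    normal_ordered p ps (n0.+1%:Z * i + a%:Z)
      (l - (n0.+1%:Z * i + a%:Z)) w.
Proof.
move=> fer; rewrite /bilin (fsum_residue n0) //.
exact: bilin_finitely_supported fer _ _ _.
Qed.

Lemma vertex_op_scaled (K : fieldType) (qp : rat -> K) (u : K)
    (V : lmodType K) (p ps : int -> V -> V) (v0 : V) (lam : int -> K) k l v :
  fermions p ps v0 -> (forall i, lam i != 0) ->
  vertex_op qp u (fun i v => lam i *: p i v)
    (fun j v => (lam (- j))^-1 *: ps j v) k l v =
  bilin p ps (fun i => u ^ k * fpow_weight qp k l i * (lam i / lam (i - l))) l v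
  + (u ^ k * vertex_constant qp k l) *: v.
Proof.
move=> fer lam0; rewrite /vertex_op scalerDr scalerA; congr (_ + _).
rewrite -(bilinZ (scaled_fermions fer lam0)); apply: eq_fsumr => i.
by rewrite (normal_ordered_scaled _ _ _ _ fer) scalerA opprB.
Qed.

Section TwistedModes.
Variables (K : fieldType) (q : K) (qp : rat -> K) (n0 : nat).
Local Notation n := n0.+1.
Variables (sigma : 'M[int]_2) (u u1n : K).
Hypotheses (q0 : q != 0) (hqp : fractional_powers q qp).
Hypotheses (u0 : u != 0) (hu1n : u1n ^+ n = u).
Local Notation m' := (sigma 0 0).
Local Notation m := (sigma 0 1).
Local Notation n' := (sigma 1 0).
Hypotheses (hn : sigma 1 1 = n%:Z) (hdet : m' * n%:Z - m * n' = 1).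

(* Chosen so that lam_i / lam_(i-L) is u^(-mL/n) q^(-mL(2i-L)/(2n)), which
   turns the weight u^K q^(K(2i-L)/2) of sigma(E_{k,l}) = E_{K,L} into
   u^(k/n) q^(k(2i-L)/(2n)), as nK - mL = k. *)
Definition twist_factor (i : int) : K :=
  u1n ^ (- (m * i)) * qp (- ((m * i ^+ 2)%:~R / (2 * n)%:R)).

Definition twisted_psi (i : int) (v : fock K n) : fock K n :=
  twist_factor i *: psi_mode i v.
Definition twisted_psis (j : int) (v : fock K n) : fock K n :=
  (twist_factor (- j))^-1 *: psis_mode j v.

Lemma root_neq0 : u1n != 0.
Proof. by apply: contra u0 => /eqP h; rewrite -hu1n h expr0n. Qed.

Lemma twist_factor_neq0 i : twist_factor i != 0.
Proof. by rewrite mulf_neq0 ?expfz_neq0 ?root_neq0 ?(fpow_neq0 q0 hqp). Qed.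

Lemma twisted_fermions : fermions twisted_psi twisted_psis (vac K n).
Proof. exact: scaled_fermions (fock_fermions K n0) twist_factor_neq0. Qed.

Definition twisted_rep (x : diff K) (v : fock K n) : fock K n :=
  diff_rep qp u twisted_psi twisted_psis (diff_twist sigma x) v.

Definition twisted_weight (k L i : int) : K :=
  qp ((k * (2 * i - L))%:~R / (2 * n)%:R).

Lemma twisted_rep_dE (k l k1 l1 : int) w : (k, l) != (0, 0) ->
  k1 = m' * k + m * l -> l1 = n' * k + n%:Z * l ->
  twisted_rep (dE K k l) w =
    bilin (@psi_mode K n0) (@psis_mode K n0)
      (fun i => u1n ^ k * twisted_weight k l1 i) l1 w
    + (u ^ k1 * vertex_constant qp k1 l1) *: w.
Proof.
move=> kl hk1 hl1; rewrite /twisted_rep diff_twist_dE hn -hk1 -hl1.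
have hk : k = n%:Z * k1 - m * l1.
  by rewrite hk1 hl1 -[LHS]mul1r -hdet; ring.
have hl : l = m' * l1 - n' * k1.
  by rewrite hk1 hl1 -[LHS]mul1r -hdet; ring.
rewrite diff_rep_dE; last first.
  apply: contra kl => /eqP[h1 h2].
  by rewrite hk hl h1 h2 !mulr0 subrr.
apply: etrans (vertex_op_scaled qp u _ _ _ (fock_fermions K n0)
  twist_factor_neq0) _.
apply: (congr1 (fun t => t + _)); apply: eq_bilin => i.
rewrite /fpow_weight /twisted_weight /twist_factor.
rewrite invfM -(fpowN q0 hqp) opprK invr_expz opprK.
transitivity (u ^ k1 * u1n ^ (- (m * i)) * u1n ^ (m * (i - l1)) *
  (qp ((k1 * (2 * i - l1))%:~R / 2) * qp (- ((m * i ^+ 2)%:~R / (2 * n)%:R)) *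
   qp ((m * (i - l1) ^+ 2)%:~R / (2 * n)%:R))).
  move: (u ^ _) (u1n ^ _) (u1n ^ _) (qp _) (qp _) (qp _) => *; ring.
rewrite -!(fpowD hqp) -hu1n (exprnP u1n) exprz_exp -!expfzDr ?root_neq0 //.
congr (u1n ^ _ * qp _); first by rewrite hk; ring.
by rewrite hk; field; rewrite nat1r pnatr_eq0.
Qed.

Lemma H_tw_rep k w : k != 0 -> twisted_rep (dE K 0 k) w = H_tw k w.
Proof.
move=> k0; rewrite (@twisted_rep_dE _ _ (m * k) (n%:Z * k)) ?xpair_eqE ?mulr0
  ?add0r //.
have nk : n%:Z * k != 0 by rewrite mulf_neq0.
rewrite /vertex_constant (negPf nk) mul0r mulr0 scale0r addr0 /H_tw /bilin.
rewrite (fsum_residue n0);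
  last exact: bilin_finitely_supported (fock_fermions K n0) _ _ _.
apply: eq_bigr => a _; apply: eq_fsumr => i.
rewrite /twisted_weight mul0r mul0r (fpow0 q0 hqp) mulr1 expr0z scale1r.
have := normal_orderedE (fock_fermions K n0) (n%:Z * i + a%:Z)
  (n%:Z * k - (n%:Z * i + a%:Z)) w.
rewrite (_ : (_ + (_ - _) == 0) = false) ?scale0r ?addr0 => [<-|]; last first.
  by rewrite addrC subrK (negPf nk).
rewrite psi_modeE (_ : n%:Z * k - (n%:Z * i + a%:Z) = n%:Z * (k - i) - a%:Z).
  by rewrite psis_modeE.
by ring.
Qed.

(* E^tw for e = 1 and F^tw for e = -1. *)
Definition signed_current (e : int) : current K n := fun N w =>
  \sum_(a < n) \sum_(b < n | (b%:Z - a%:Z == - (e * n') %[mod n%:Z])%Z)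
    monomial_mul (u1n ^ e * qp (- (e%:~R / 2)) *
        qp (e%:~R * ((a + b)%:R / (2 * n)%:R)))
      (1 + ((e * n' - a%:Z + b%:Z) %/ n%:Z)%Z)
      (rprod (qp (- (e%:~R / 2))) a (qp (e%:~R / 2)) b) N w.

Lemma normal_ordered_modeE (a b : 'I_n) i j w :
  normal_ordered (@psi_mode K n0) (@psis_mode K n0) (n%:Z * i + a%:Z)
    (n%:Z * j - b%:Z) w = nord a i b j w.
Proof.
rewrite /normal_ordered /nord psi_modeE psis_modeE.
by rewrite (_ : (n%:Z * i + a%:Z < 0) = (i < 0)) //; have := ltn_ord a; nia.
Qed.

Lemma residue_cond (a b : 'I_n) (x : int) :
  ((b%:Z - a%:Z == - x %[mod n%:Z])%Z) = (b == residue n0 (a%:Z - x)).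
Proof.
have -> : (b == residue n0 (a%:Z - x)) = (b%:Z == ((a%:Z - x) %% n%:Z)%Z).
  by rewrite -residueE eqz_nat.
rewrite -[b%:Z in RHS](@modz_small _ n%:Z); last by have := ltn_ord b; lia.
by rewrite !eqz_mod_dvd; congr (_ %| _)%Z; ring.
Qed.

Lemma divisor_eq1 (t : int) : n%:Z * t = 1 -> n0 = 0%N.
Proof.
move=> h; have [t0|t1] : t <= 0 \/ 1 <= t by lia.
  have : n%:Z * t <= 0 by rewrite pmulr_rle0.
  lia.
have : n%:Z * 1 <= n%:Z * t by rewrite ler_pM2l.
lia.
Qed.

(* A constant term can only occur if n divides n', hence only for n = 1. *)
Lemma signed_current_constant (e l x : int) (a : 'I_n) :
  e * e = 1 -> x = e * n' ->
  a = residue n0 (a%:Z - x) \/ x + n%:Z * l = 0 -> n0 = 0%N.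
Proof.
move=> e1 hx [ha|hL].
  have := divz_eq (a%:Z - x) n%:Z; rewrite -residueE -ha.
  set s := (_ %/ _)%Z => hs; apply: (@divisor_eq1 (m' + m * (e * s))).
  have hn' : n' = - (e * s * n%:Z).
    by rewrite -[n']mul1r -e1 -mulrA -hx (_ : x = - (s * n%:Z)) ?mulrN ?mulrA
      //; lia.
  by rewrite -hdet hn'; ring.
apply: (@divisor_eq1 (m' + m * (e * l))).
have hn' : n' = - (e * l * n%:Z).
  by rewrite -[n']mul1r -e1 -mulrA -hx (_ : x = - (l * n%:Z)) ?mulrN ?mulrA //;
    lia.
by rewrite -hdet hn'; ring.
Qed.

Lemma finitely_supported_residue (V : zmodType) (F : int -> V) (a : 'I_n) :
  finitely_supported F ->
  finitely_supported (fun i => F (n%:Z * i + a%:Z)).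
Proof.
move=> [s hs]; exists [fset (i %/ n%:Z)%Z | i in s]%fset => i hi; apply: hs.
apply: contra hi => hi; apply/imfsetP; exists (n%:Z * i + a%:Z) => //=.
by rewrite divzMDord.
Qed.

Lemma signed_current_rep (e l : int) w : e * e = 1 ->
  twisted_rep (dE K e l) w = signed_current e (- l) w.
Proof.
move=> e1; have e0 : e != 0 by apply/eqP => e0; rewrite e0 in e1.
pose x := e * n'; pose L := x + n%:Z * l; pose k1 := m' * e + m * l.
have hL : L = n' * e + n%:Z * l by rewrite /L /x mulrC.
rewrite (@twisted_rep_dE e l k1 L) ?xpair_eqE ?negb_and ?e0 //.
rewrite /signed_current -/x.
pose b (a : 'I_n) := residue n0 (a%:Z - x).
pose s (a : 'I_n) := ((a%:Z - x) %/ n%:Z)%Z.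
have hs (a : 'I_n) : x = a%:Z - s a * n%:Z - (b a)%:Z.
  by have := divz_eq (a%:Z - x) n%:Z; rewrite -residueE -/(b a) -/(s a); lia.
pose c (a : 'I_n) := u1n ^ e * qp (- (e%:~R / 2)) * qp (e%:~R * ((a + b a)%:R /
  (2 * n)%:R)).
pose D (a : 'I_n) := ((a == b a) && (l == s a))%:R / (qp (- (e%:~R / 2)) - qp
  (e%:~R / 2)).
pose C (a : 'I_n) i := qp (- (e%:~R / 2)) ^ (- i - 1) * qp (e%:~R / 2) ^ (i - l
  + s a).
pose X (a : 'I_n) i := normal_ordered (@psi_mode K n0) (@psis_mode K n0)
  (n%:Z * i + a%:Z) (L - (n%:Z * i + a%:Z)) w.
transitivity (\sum_(a < n) c a *: (D a *: w + \sum_(i \in [set: int]) C a i *: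
  X a i));
  last first.
  apply: eq_bigr => a _.
  rewrite (big_pred1 (b a)) => [|b' /=]; last exact: residue_cond.
  rewrite /monomial_mul /rprod /nprod -/(c a).
  have -> : ((x - a%:Z + (b a)%:Z) %/ n%:Z)%Z = - s a.
    by rewrite (_ : _ + _ = - s a * n%:Z) ?mulzK //; have := hs a; lia.
  apply: (congr1 (fun v => c a *: v)); apply: (congr2 +%R).
    by apply: (congr1 (fun d => d *: w)); rewrite /D; congr ((_ && _)%:R / _);
      lia.
  apply: eq_fsumr => i; apply: (congr2 (fun d v => d *: v)).
    by rewrite /C; congr (_ * _ ^ _); lia.
  apply: etrans _ (normal_ordered_modeE a (b a) i _ w).
  apply: (congr1 (fun j => normal_ordered (@psi_mode K n0) (@psis_mode K n0) _
    j w)).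
  by rewrite /L (hs a); ring.
have hX (a : 'I_n) : finitely_supported (X a).
  exact: (finitely_supported_residue a
    (normal_ordered_finitely_supported (fock_fermions K n0) L w)).
apply/esym/(etrans (fsum_affine w c D C hX))/esym.
apply: (congr2 +%R).
  apply: (etrans (bilin_residue n0 _ _ _ (fock_fermions K n0))).
  apply: eq_bigr => a _; apply: eq_fsumr => i;
    apply: (congr1 (fun d => d *: X a i)).
  rewrite /c /C /twisted_weight -!(fpowMz q0 hqp).
  rewrite -!mulrA; congr (_ * _); rewrite -!(fpowD hqp); congr qp.
  by rewrite /L (hs a); field; rewrite nat1r pnatr_eq0.
apply: (congr1 (fun d => d *: w)); rewrite /vertex_constant.
have [n00|n01] := eqVneq n0 0%N; last first.
  have Lnz : (L == 0) = false.
    apply/eqP => h; move: n01.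
    by rewrite (signed_current_constant (a :=
      ord0) e1 erefl (or_intror h)) eqxx.
  rewrite Lnz mul0r mulr0 big1 // => a _; rewrite /D.
  have -> : (a == b a) = false; last by rewrite /= mul0r mulr0.
  apply/eqP => h; move: n01.
  by rewrite (signed_current_constant (l := l) e1 erefl (or_introl h)) eqxx.
have ord_eq0 (a : 'I_n) : a = ord0.
  by apply: val_inj => /=; have := ltn_ord a; lia.
have n1 : n%:Z = 1 by rewrite n00.
have hu : u = u1n by rewrite -hu1n n00 expr1.
rewrite (bigD1 ord0) //= big1 ?addr0 => [|a]; last by rewrite (ord_eq0 a) eqxx.
have b0 : b ord0 = ord0 by exact: ord_eq0.
have s0 : s ord0 = - x.
  have := hs ord0; rewrite b0 n1 /=; lia.
rewrite /c /D b0 s0 eqxx /= (_ : (l == - x) = (L == 0)); last by rewrite /L n1;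
  lia.
have [L0|_] := eqVneq L 0; last by rewrite !mul0r !mulr0.
have -> : k1 = e.
  have hl : l = - x by move: L0; rewrite /L n1; lia.
  by rewrite /k1 hl /x -[RHS]mulr1 -hdet n1; ring.
rewrite hu !mul0r !mulr0 (fpow0 q0 hqp) mulr1.
have -> : qp (- (e%:~R / 2)) - qp (e%:~R / 2) =
    qp (- (e%:~R / 2)) * (1 - qp e%:~R).
  by rewrite mulrBr mulr1 -(fpowD hqp); congr (_ - qp _); field.
by rewrite -mulrA invfM !mul1r mulVKf ?(fpow_neq0 q0 hqp).
Qed.

End TwistedModes.

Section Generation.
Variables (K : fieldType) (q : K) (qp : rat -> K) (V : lmodType K).
Hypotheses (q0 : q != 0) (hq : not_root_of_unity q).
Hypothesis hqp : fractional_powers q qp.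

Lemma diff_action_unique (rho1 rho2 : diff K -> V -> V) :
  diff_action qp rho1 -> diff_action qp rho2 ->
  (forall v, rho1 (dc K) v = rho2 (dc K) v) ->
  (forall v, rho1 (dc' K) v = rho2 (dc' K) v) ->
  (forall k v, k != 0 -> rho1 (dE K 0 k) v = rho2 (dE K 0 k) v) ->
  (forall k v, rho1 (dE K 1 k) v = rho2 (dE K 1 k) v) ->
  (forall k v, rho1 (dE K (-1) k) v = rho2 (dE K (-1) k) v) ->
  rho1 = rho2.
Proof.
move=> [ll1 lr1 br1] [ll2 lr2 br2] hc hc' h0 h1 hN1.
have hz l v : rho1 (dE K 0 l) v = rho2 (dE K 0 l) v.
  have [->|] := eqVneq l 0; last exact: h0.
  by rewrite dE00 (linear0_of (ll1 v)) (linear0_of (ll2 v)).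
have gen (e : int) : e != 0 ->
  (forall l v, rho1 (dE K e l) v = rho2 (dE K e l) v) ->
    forall (j : nat) l v, rho1 (dE K (e * j%:Z) l) v = rho2 (dE K (e * j%:Z) l)
      v.
  move=> e0 he; elim=> [|[|j] IH] l v; first by rewrite mulr0.
    by rewrite mulr1.
  (* The structure constant of [E_{ej,l1}, E_{e,l2}] vanishes only if
     l2 j = l1. *)
  have [l1 [l2 [<- nz]]] : exists l1 l2 : int,
    l1 + l2 = l /\ l2 * j.+1%:Z - l1 != 0.
    have [->|l0] := eqVneq l 0; [exists (-1), 1|exists l, 0]; split; lia.
  set c := qp ((l2 * (e * j.+1%:Z) - l1 * e)%:~R / 2) -
    qp ((l1 * e - l2 * (e * j.+1%:Z))%:~R / 2).
  have br : diff_bracket qp (dE K (e * j.+1%:Z) l1) (dE K e l2) =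
      c *: dE K (e * j.+2%:Z) (l1 + l2).
    rewrite diff_bracket_dE ifF ?addr0; last by apply/negP => /andP[/eqP h _];
      nia.
    by congr (_ *: dE K _ _); lia.
  have c0 : c != 0.
    rewrite /c (_ : l1 * e - _ = - (l2 * (e * j.+1%:Z) - l1 * e)); last by ring.
    rewrite subr_eq0; set t := _ - _; apply/eqP => h.
    have : qp t%:~R == 1.
      have -> : t%:~R = t%:~R / 2 - (- t)%:~R / 2 :> rat by field.
      by rewrite (fpowD hqp) h (fpowN q0 hqp) mulfV // (fpow_neq0 q0 hqp).
    rewrite (fpow_int_eq1 q0 hqp) // (_ : t = e * (l2 * j.+1%:Z - l1)) /t;
      last by ring.
    by rewrite mulf_eq0 (negPf e0) (negPf nz).
  have h : c *: rho1 (dE K (e * j.+2%:Z) (l1 + l2)) v =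
      c *: rho2 (dE K (e * j.+2%:Z) (l1 + l2)) v.
    rewrite -(linearZ_of _ _ (ll1 v)) -(linearZ_of _ _ (ll2 v)) -br br1 br2.
    by rewrite !IH !he.
  exact: scalerI c0 _ _ h.
apply/funext => x; apply/funext => v; move: x; apply: diff_ext => // k l.
have [k0|k0] := leP 0 k.
  have -> : k = 1 * (absz k)%:Z by lia.
  exact: gen.
have -> : k = -1 * (absz k)%:Z by lia.
exact: gen.
Qed.

End Generation.

Lemma eq_monomial_rprod (K : fieldType) (n : nat) (c c' al al' be be' : K)
    (d d' N : int) (a b : 'I_n) w :
  c = c' -> d = d' -> al = al' -> be = be' ->
  monomial_mul c d (rprod al a be b) N w =
  monomial_mul c' d' (rprod al' a be' b) N w.
Proof. by move=> -> -> -> ->. Qed.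

Section TwistedAction.
Variables (K : fieldType) (q : K) (qp : rat -> K) (n0 : nat).
Local Notation n := n0.+1.
Variables (sigma : 'M[int]_2) (u u1n : K).
Hypotheses (q0 : q != 0) (hq : not_root_of_unity q).
Hypotheses (hqp : fractional_powers q qp).
Hypotheses (u0 : u != 0) (hu1n : u1n ^+ n = u).
Hypotheses (hsigma : \det sigma = 1) (hn : sigma 1 1 = n%:Z).

Lemma det_expanded : sigma 0 0 * n%:Z - sigma 0 1 * sigma 1 0 = 1.
Proof.
rewrite -hn -hsigma (expand_det_row _ 0) !big_ord_recl big_ord0 addr0 /cofactor.
rewrite !det_mx11 !mxE /= !(expr0, expr1, mul1r, mulN1r, mulrN).
by congr (sigma _ _ * sigma _ _ - sigma _ _ * sigma _ _); apply: val_inj.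
Qed.

Local Notation rep := (@twisted_rep K qp n0 sigma u u1n).
Local Notation fer := (twisted_fermions sigma q0 hqp u0 hu1n).

Lemma diff_twist_linear : linear (@diff_twist K sigma).
Proof. by move=> a x y; exact: linearP. Qed.

Lemma twisted_rep_action : diff_action qp rep.
Proof.
have [ll lr br] := diff_rep_action q0 hq hqp u0 fer.
split.
- by move=> v; exact: linear_comp_fun (ll v) diff_twist_linear.
- by move=> x; exact: lr.
- by move=> x y v; rewrite /twisted_rep (diff_twist_bracket _ _ _ hsigma);
  exact: br.
Qed.

Lemma E_tw_signed w N : E_tw qp (sigma 1 0) u1n N w =
  @signed_current K qp n0 sigma u1n 1 N w.
Proof.
apply: eq_bigr => a _; apply: eq_big => [b|b _]; first by rewrite mul1r.
by apply: eq_monomial_rprod => //; rewrite !mul1r.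
Qed.

Lemma F_tw_signed w N : F_tw qp (sigma 1 0) u1n N w =
  @signed_current K qp n0 sigma u1n (-1) N w.
Proof.
have e1 : 1 / 2 = - ((-1)%:~R / 2) :> rat by field.
have e2 : - (1 / 2) = (-1)%:~R / 2 :> rat by field.
apply: eq_bigr => a _; apply: eq_big => [b|b _]; first by rewrite mulN1r opprK.
by apply: eq_monomial_rprod; rewrite -?e1 -?e2 ?mulN1r.
Qed.

Lemma twisted_rep_is_twisted : is_twisted_action qp (sigma 1 0) u1n rep.
Proof.
have hdet := det_expanded.
split; first exact: twisted_rep_action.
split.
- move=> w; rewrite /twisted_rep.
  have -> : diff_twist sigma (dc K) = (sigma 0 1)%:~R *: dc' K + (sigma 1
    1)%:~R *: dc K.
    by exact: lextU.
  by apply: etrans (diff_rep_central _ _ _ _ _ _ _) _; rewrite hn.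
- move=> w; rewrite /twisted_rep.
  have -> : diff_twist sigma (dc' K) = (sigma 0 0)%:~R *: dc' K + (sigma 1
    0)%:~R *: dc K.
    by exact: lextU.
  exact: diff_rep_central.
- move=> k w k0; exact: (H_tw_rep q0 hqp u0 hu1n hn hdet w k0).
- move=> k w; rewrite E_tw_signed.
  exact: (signed_current_rep q0 hqp u0 hu1n hn hdet).
- move=> k w; rewrite F_tw_signed.
  exact: (signed_current_rep q0 hqp u0 hu1n hn hdet).
Qed.

Lemma twisted_action_unique rho :
  is_twisted_action qp (sigma 1 0) u1n rho -> rep = rho.
Proof.
have [act1 [c1 c'1 H1 E1 F1]] := twisted_rep_is_twisted.
move=> [act2 [c2 c'2 H2 E2 F2]].
apply: (diff_action_unique q0 hq hqp act1 act2).
- by move=> v; rewrite c1 c2.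
- by move=> v; rewrite c'1 c'2.
- by move=> k v k0; rewrite H1 // H2.
- by move=> k v; rewrite E1 E2.
- by move=> k v; rewrite F1 F2.
Qed.

Lemma twisted_fermion_map (W : lmodType K) (p ps : int -> W -> W) (w0 : W) :
  fermions p ps w0 -> exists f : fock K n -> W,
  [/\ linear f, f (vac K n) = w0,
      forall i v, f (twisted_psi qp sigma u1n i v) = p i (f v)
    & forall j v, f (twisted_psis qp sigma u1n j v) = ps j (f v)].
Proof.
move=> ferW; pose lam i := twist_factor qp n0 sigma u1n i.
have lam0 i : lam i != 0 by exact: (twist_factor_neq0 sigma q0 hqp u0 hu1n).
have lamV0 i : (lam i)^-1 != 0 by rewrite invr_eq0.
have [f [lf f0 fp fps]] := fock_fermion_map n0 (scaled_fermions ferW lamV0).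
exists f; split=> // [i v|j v].
  by rewrite /twisted_psi (linearZ_of _ _ lf) fp scalerA mulfV // scale1r.
by rewrite /twisted_psis (linearZ_of _ _ lf) fps scalerA invrK mulVf // scale1r.
Qed.

End TwistedAction.

(** * Comparison of the modules *)

Section MuAction.
Variables (K : fieldType) (qp : rat -> K) (q u : K).
Hypotheses (q0 : q != 0) (hqp : fractional_powers q qp).

Lemma E_tw_single N w : E_tw qp 0 u N w =
  monomial_mul (u * qp (- (1 / 2))) 1
    (rprod (qp (- (1 / 2))) (ord0 : 'I_1) (qp (1 / 2)) ord0) N w.
Proof.
rewrite /E_tw big_ord_recl big_ord0 big_mkcond big_ord_recl big_ord0 /= !addr0.
by apply: eq_monomial_rprod => //; rewrite addn0 mul0r (fpow0 q0 hqp) mulr1.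
Qed.

Lemma F_tw_single N w : F_tw qp 0 u N w =
  monomial_mul (u^-1 * qp (1 / 2)) 1
    (rprod (qp (1 / 2)) (ord0 : 'I_1) (qp (- (1 / 2))) ord0) N w.
Proof.
rewrite /F_tw big_ord_recl big_ord0 big_mkcond big_ord_recl big_ord0 /= !addr0.
by apply: eq_monomial_rprod => //;
  rewrite addn0 mul0r oppr0 (fpow0 q0 hqp) mulr1.
Qed.

Lemma H_tw_single k (w : fock K 1) : H_tw k w =
  \sum_(i \in [set: int]) psi ord0 i (psis ord0 (k - i) w).
Proof. by rewrite /H_tw big_ord_recl big_ord0 addr0. Qed.

Lemma Mu_action_twisted rho :
  is_Mu_action qp u rho <-> is_twisted_action qp 0 u rho.
Proof.
split=> -[act [c c' H E F]]; (split; first exact: act); split.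
- by move=> w; rewrite c scale1r.
- by move=> w; rewrite c' scale0r.
- by move=> k w k0; apply: etrans (H k w k0) (esym (H_tw_single k w)).
- by move=> k w; apply: etrans (E k w) (esym (E_tw_single _ w)).
- by move=> k w; apply: etrans (F k w) (esym (F_tw_single _ w)).
- by move=> w; rewrite c scale1r.
- by move=> w; rewrite c' scale0r.
- by move=> k w k0; apply: etrans (H k w k0) (H_tw_single k w).
- by move=> k w; apply: etrans (E k w) (E_tw_single _ w).
- by move=> k w; apply: etrans (F k w) (F_tw_single _ w).
Qed.

End MuAction.

Lemma diff_twist1 (K : fieldType) (x : diff K) : diff_twist 1%:M x = x.
Proof.
move: x; apply: (@diff_ext _ _ (diff_twist 1%:M) (fun x => x)).
- exact: diff_twist_linear.
- by [].
- by move=> k l; rewrite diff_twist_dE !mxE /= !mul1r !mul0r add0r addr0.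
- by apply: etrans (lextU _ _) _; rewrite /= !mxE /= scale0r add0r scale1r.
- by apply: etrans (lextU _ _) _; rewrite /= !mxE /= scale0r addr0 scale1r.
Qed.

Lemma fermion_maps_cancel (K : fieldType) (V W : lmodType K)
    (p ps : int -> V -> V) (v0 : V) (p' ps' : int -> W -> W) (w0 : W)
    (f : V -> W) (g : W -> V) :
  fermions p ps v0 -> linear f -> linear g -> f v0 = w0 -> g w0 = v0 ->
  (forall i v, f (p i v) = p' i (f v)) ->
  (forall i v, f (ps i v) = ps' i (f v)) ->
  (forall i w, g (p' i w) = p i (g w)) ->
  (forall i w, g (ps' i w) = ps i (g w)) ->
  cancel f g.
Proof.
move=> fer lf lg f0 g0 fp fps gp gps.
apply: (fermion_ind fer); first by rewrite f0.
- by move=> c x y hx hy; rewrite lf lg hx hy.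
- by move=> i x hx; rewrite fp gp hx.
- by move=> i x hx; rewrite fps gps hx.
Qed.

Lemma diff_rep_iso (K : fieldType) (qp : rat -> K) (u : K) (V W : lmodType K)
    (p ps : int -> V -> V) (v0 : V) (p' ps' : int -> W -> W) (w0 : W)
    (f : V -> W) (g : W -> V) (tau : diff K -> diff K) :
  fermions p ps v0 -> fermions p' ps' w0 ->
  linear f -> linear g -> f v0 = w0 -> g w0 = v0 ->
  (forall i v, f (p i v) = p' i (f v)) ->
  (forall i v, f (ps i v) = ps' i (f v)) ->
  (forall i w, g (p' i w) = p i (g w)) ->
  (forall i w, g (ps' i w) = ps i (g w)) ->
  diff_module_iso (fun x => diff_rep qp u p ps (tau x))
    (fun x => diff_rep qp u p' ps' (tau x)).
Proof.
move=> fer fer' lf lg f0 g0 fp fps gp gps.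
pose F := GRing.isLinear.Build _ _ _ _ f lf.
pose f' : {linear V -> W} := HB.pack f F.
exists f'; split; last by move=> x v; exact: diff_rep_intertwine fer lf fp fps.
exists g; first exact: (fermion_maps_cancel fer lf lg f0 g0 fp fps gp gps).
exact: (fermion_maps_cancel fer' lg lf g0 f0 gp gps fp fps).
Qed.

Theorem theorem4p1 (R : realType) (q : R[i]) (qp : rat -> R[i])
    (sigma : 'M[int]_2) (n : nat) (u u1n : R[i])
    (hq0 : q != 0) (hq : not_root_of_unity q) (hqp : fractional_powers q qp)
    (hsigma : \det sigma = 1) (hn : sigma 1 1 = n%:Z) (hn0 : (0 < n)%N)
    (hu : u != 0) (hu1n : u1n ^+ n = u) :
  let n' := sigma 1 0 in
  [/\ exists! rho : diff R[i] -> fock R[i] n -> fock R[i] n,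
        is_twisted_action qp n' u1n rho,
      exists! rhoM : diff R[i] -> fock R[i] 1 -> fock R[i] 1,
        is_Mu_action qp u rhoM
    & forall (rho : diff R[i] -> fock R[i] n -> fock R[i] n)
             (rhoM : diff R[i] -> fock R[i] 1 -> fock R[i] 1),
        is_twisted_action qp n' u1n rho -> is_Mu_action qp u rhoM ->
        diff_module_iso rho (fun x : diff R[i] => rhoM (diff_twist sigma x))].
Proof.
case: n hn hn0 hu1n => // n0 hn _ hu1n n'.
have hn1 : (1%:M : 'M[int]_2) 1 1 = 1%:Z by rewrite mxE.
have n'1 : (1%:M : 'M[int]_2) 1 0 = 0 by rewrite mxE.
have ex := twisted_rep_is_twisted hq0 hq hqp hu hu1n hsigma hn.
have un := twisted_action_unique hq0 hq hqp hu hu1n hsigma hn.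
have ex1 := twisted_rep_is_twisted hq0 hq hqp hu (expr1 u) (det1 _ _) hn1.
have un1 := twisted_action_unique hq0 hq hqp hu (expr1 u) (det1 _ _) hn1.
rewrite n'1 in ex1 un1.
have eqM := Mu_action_twisted u hq0 hqp.
split.
- by exists (twisted_rep qp sigma u u1n); split; [exact: ex|exact: un].
- exists (twisted_rep qp 1%:M u u); split; first exact/eqM/ex1.
  by move=> rho /eqM; exact: un1.
move=> rho rhoM /un <- /eqM/un1 <-.
have fer := twisted_fermions sigma hq0 hqp hu hu1n.
have fer1 := twisted_fermions 1%:M hq0 hqp hu (expr1 u).
have [f [lf f0 fp fps]] := twisted_fermion_map sigma hq0 hqp hu hu1n fer1.
have [g [lg g0 gp gps]] := twisted_fermion_map 1%:M hq0 hqp hu (expr1 u) fer.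
have -> : (fun x => @twisted_rep _ qp 0 1%:M u u (diff_twist sigma x)) =
    fun x => diff_rep qp u (twisted_psi qp 1%:M u) (twisted_psis qp 1%:M u)
      (diff_twist sigma x).
  by apply: funext => x; rewrite /twisted_rep diff_twist1.
exact: (diff_rep_iso qp u (diff_twist sigma) fer fer1 lf lg f0 g0 fp fps gp
  gps).
Qed.
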